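(* For every sufficiently large integer $m$, the tau function $s=\tau(z)$ (the inverse of $\chi$ restricted to $D_m$) is a conformal mapping of the slit plane $S_m$ onto the strip $D_m$.
   Context: $\chi(s)=2^s\pi^{s-1}\sin(\frac{\pi s}{2})\Gamma(1-s)$, with $s=\sigma+it$. In the upper half-plane, $\arg(\chi(s))$ denotes the continuous (real-valued, not reduced modulo $2\pi$) branch of the argument normalized by $\arg(\chi(\frac12+it))=t-t\log\frac{t}{2\pi}+\frac{\pi}{4}+o(1)$ as $t\to+\infty$. Let $M_1,M_2>0$ be constants such that $|\chi(\sigma+it)|$ is strictly decreasing in $\sigma$ for each $t\ge M_1$, and, for each $\sigma$, $\arg(\chi(\sigma+it))$ is strictly decreasing in $t$ for $t\ge M_2$ and tends to $-\infty$ as $t\to+\infty$. Fix a suitably large $M\ge\max(M_1,M_2)$ and let $D=\{s=\sigma+it: t\ge \max(M_1,M_2),\ \arg(\chi(s))\le\arg(\chi(\frac12+iM))\}$. For $\phi\le\arg(\chi(\frac12+iM))$ let $\gamma_\phi=\{s\in D:\arg(\chi(s))=\phi\}$. For $m$ sufficiently large put $$D_m=\bigcup_{-2\pi(m+1)<\phi<-2\pi m}\gamma_\phi .$$ $S_m$ is the slit plane $\mathbb{C}\setminus[0,+\infty)$, regarded as the sheet of the Riemann surface of the logarithm on which $-2\pi(m+1)<\arg(z)<-2\pi m$. The map $\chi:D_m\to S_m$ is a bijection, and $\tau(z)=\chi^{-1}(z)$ is its inverse $S_m\to D_m$. *)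

(* Defs.v *)
(* Stdlib reals and Coquelicot's complex numbers [C = R * R]; the point
   sigma + i t is the pair [(sigma, t)]. *)
From Stdlib Require Export Reals ZArith.
From Coquelicot Require Export Coquelicot.
Open Scope R_scope.

Definition Cexp (z : C) : C :=
  (exp (Re z) * cos (Im z), exp (Re z) * sin (Im z)).

Definition Csin (z : C) : C :=
  ((Cexp (Ci * z) - Cexp (- (Ci * z))) / (2 * Ci))%C.

(* x ^ z with the real logarithm of the base; meant for x > 0 only. *)
Definition Rcpow (x : R) (z : C) : C := Cexp (z * RtoC (ln x)).

Fixpoint rising (z : C) (n : nat) : C :=
  match n with
  | O => RtoC 1
  | S k => (rising z k * (z + RtoC (INR k)))%C
  end.

(* Gauss's formula Gamma(z) = lim n! n^z / (z (z+1) ... (z+n)), valid off the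
   poles 0, -1, -2, ...; at the poles the value is a junk one. *)
Definition gauss_term (z : C) (n : nat) : C :=
  (RtoC (INR (fact n)) * Rcpow (INR n) z / rising z (S n))%C.

Definition CGamma (z : C) : C :=
  (real (Lim_seq (fun n => Re (gauss_term z n))),
   real (Lim_seq (fun n => Im (gauss_term z n)))).

Definition chi (s : C) : C :=
  (Rcpow 2 s * Rcpow PI (s - 1) * Csin (RtoC PI * s / 2) * CGamma (1 - s))%C.

(* These conditions determine the values of [A] on the open upper half-plane,
   where chi has neither zeros nor poles; elsewhere [A] is arbitrary. *)
Definition is_arg_chi (A : C -> R) : Prop :=
  (forall s : C, 0 < Im s -> continuous A s) /\
  (forall s : C, 0 < Im s ->
     chi s = (RtoC (Cmod (chi s)) * Cexp (Ci * RtoC (A s)))%C) /\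
  is_lim (fun t => A (1 / 2, t) - (t - t * ln (t / (2 * PI)) + PI / 4))
         p_infty 0.

Definition Cmod_chi_decreasing_from (M1 : R) : Prop :=
  forall t : R, M1 <= t ->
  forall sigma1 sigma2 : R, sigma1 < sigma2 ->
    Cmod (chi (sigma2, t)) < Cmod (chi (sigma1, t)).

Definition arg_chi_decreasing_from (A : C -> R) (M2 : R) : Prop :=
  forall sigma : R,
    (forall t1 t2 : R, M2 <= t1 -> t1 < t2 -> A (sigma, t2) < A (sigma, t1)) /\
    is_lim (fun t => A (sigma, t)) p_infty m_infty.

Definition D (A : C -> R) (M1 M2 M : R) (s : C) : Prop :=
  Rmax M1 M2 <= Im s /\ A s <= A (1 / 2, M).

Definition gamma (A : C -> R) (M1 M2 M phi : R) (s : C) : Prop :=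
  D A M1 M2 M s /\ A s = phi.

Definition D_m (A : C -> R) (M1 M2 M : R) (m : Z) (s : C) : Prop :=
  exists phi : R,
    - 2 * PI * (IZR m + 1) < phi < - 2 * PI * IZR m /\ gamma A M1 M2 M phi s.

(* C minus [0, +oo).  Every sheet S_m projects bijectively and
   conformally onto this set, and z serves as the coordinate on S_m.  The
   argument that labels the sheet is recovered as A (tau z), which lies in
   (-2 pi (m+1), -2 pi m) by the definition of [D_m]. *)
Definition slit_plane (z : C) : Prop := ~ (Im z = 0 /\ 0 <= Re z).

(* f : U -> V is a bijection with inverse g : V -> U. *)
Definition inverse_between (f g : C -> C) (U V : C -> Prop) : Prop :=
  (forall s : C, U s -> V (f s) /\ g (f s) = s) /\
  (forall z : C, V z -> U (g z) /\ f (g z) = z).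

(* [is_derive] over [C_AbsRing] is complex differentiability. *)
Definition conformal_onto (f : C -> C) (U V : C -> Prop) : Prop :=
  open U /\
  (forall z : C, U z -> exists l : C,
     @is_derive C_AbsRing C_NormedModule f z l /\ l <> RtoC 0) /\
  (forall z1 z2 : C, U z1 -> U z2 -> f z1 = f z2 -> z1 = z2) /\
  (forall s : C, V s <-> exists z : C, U z /\ f z = s).

(* Main.v *)
Require Import Defs.
From Stdlib Require Import Lra Lia Psatz Classical ClassicalEpsilon.

(** By Gauss's formula, Gamma is holomorphic off the real line with
    logarithmic derivative psi(z) = lim (ln n - sum_(k <= n) 1 / (z + k)), so
    chi' = chi L with L(s) = ln (2 pi) + (pi / 2) cot (pi s / 2) - psi (1 - s).
    For t >= 100 the cotangent is almost -i, and comparing the sum with a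
    logarithm and an arctangent gives: Re L < 0 everywhere, Im L < 0 for
    sigma <= -t and Im L > 0 for sigma >= t + 1.  As Im L is the
    sigma-derivative of arg chi, the argument is bounded below on each
    horizontal line; as it decreases in t, for m large D_m lies strictly above
    t = max (M1, M2, 100), hence is open, and chi' = chi L has no zero on it.
    Then chi is an open map on D_m, so its inverse tau is continuous, and
    differentiable with derivative 1 / chi'. *)

(** * Complex derivatives *)

(** Injectivity and surjectivity of [tau] come from [inverse_between]; the work lies in its
    differentiability. The obstacle is that [D] contains its lower edge t = max (M1, M2): around a
    point of [D_m] on that edge there would be no neighbourhood inside [D_m] for an open map
    argument. The edge is an unbounded line, so continuity of the argument alone gives no lower
    bound there; the signs of Im L far to the left and right reduce the question to a compact
    segment. Those two regions are where 1 - s has real part at least t + 1, so that the sum for Im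
    psi is small, or at most -t, so that the sum runs across the peak of t / (u^2 + t^2). The value
    100 is a round threshold leaving slack in every numerical estimate. That chi has no zero for t
    >= M1 follows from the strict decrease of |chi| in sigma. The analysis rests on
    differentiability at points and the real mean value theorem. *)

Definition cont_at (f : C -> C) (z : C) : Prop :=
  forall eps : R, 0 < eps -> exists d : R, 0 < d /\
    forall w : C, Cmod (w - z) < d -> Cmod (f w - f z) < eps.

(* Caratheodory's form of the complex derivative: the product, chain and
   inverse rules reduce to algebra of continuous functions. *)
Definition cderiv (f : C -> C) (z l : C) : Prop :=
  exists q : C -> C, cont_at q z /\ q z = l /\
    exists d : R, 0 < d /\
      forall w : C, Cmod (w - z) < d -> (f w - f z = q w * (w - z))%C.

Lemma Cmod_minus_sym (a b : C) : Cmod (a - b) = Cmod (b - a).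
Proof. rewrite <- Cmod_opp. f_equal. ring. Qed.

Lemma Cmod_rev_triangle (a b : C) : Cmod a - Cmod b <= Cmod (a - b).
Proof.
  pose proof (Cmod_triangle (a - b) b) as H.
  replace (a - b + b)%C with a in H by ring. lra.
Qed.

Lemma im_le_Cmod (c : C) : Rabs (Im c) <= Cmod c.
Proof. apply Rle_trans with (2 := Rmax_Cmod c), Rmax_r. Qed.

Lemma Cmod_le_re_im (c : C) : Cmod c <= Rabs (Re c) + Rabs (Im c).
Proof.
  replace c with (RtoC (Re c) + Ci * RtoC (Im c))%C at 1.
  - eapply Rle_trans; [apply Cmod_triangle|].
    rewrite Cmod_mult, Cmod_Ci, !Cmod_R; lra.
  - destruct c as [x y]; unfold Ci, RtoC, Cplus, Cmult; simpl; f_equal; ring.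
Qed.

Lemma cont_at_const (c z : C) : cont_at (fun _ => c) z.
Proof.
  intros eps He; exists 1; split; [lra|]; intros w _.
  replace (c - c)%C with (RtoC 0) by ring; rewrite Cmod_0; lra.
Qed.

Lemma cont_at_id (z : C) : cont_at (fun w => w) z.
Proof. intros eps He; exists eps; split; auto. Qed.

Lemma cont_at_plus (f g : C -> C) (z : C) :
  cont_at f z -> cont_at g z -> cont_at (fun w => f w + g w)%C z.
Proof.
  intros Hf Hg eps He.
  destruct (Hf (eps / 2) ltac:(lra)) as [d1 [Hd1 H1]].
  destruct (Hg (eps / 2) ltac:(lra)) as [d2 [Hd2 H2]].
  exists (Rmin d1 d2); split; [apply Rmin_glb_lt; auto|]; intros w Hw.
  specialize (H1 w (Rlt_le_trans _ _ _ Hw (Rmin_l _ _))).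
  specialize (H2 w (Rlt_le_trans _ _ _ Hw (Rmin_r _ _))).
  replace (f w + g w - (f z + g z))%C with ((f w - f z) + (g w - g z))%C by ring.
  eapply Rle_lt_trans; [apply Cmod_triangle|lra].
Qed.

Lemma cont_at_locally_bounded (f : C -> C) (z : C) :
  cont_at f z -> exists d : R, 0 < d /\
    forall w : C, Cmod (w - z) < d -> Cmod (f w) <= Cmod (f z) + 1.
Proof.
  intros Hf; destruct (Hf 1 ltac:(lra)) as [d [Hd H]].
  exists d; split; auto; intros w Hw; specialize (H w Hw).
  pose proof (Cmod_rev_triangle (f w) (f z)); lra.
Qed.

Lemma cont_at_mult (f g : C -> C) (z : C) :
  cont_at f z -> cont_at g z -> cont_at (fun w => f w * g w)%C z.
Proof.
  intros Hf Hg eps He.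
  pose proof (Cmod_ge_0 (f z)) as Pf; pose proof (Cmod_ge_0 (g z)) as Pg.
  destruct (cont_at_locally_bounded f z Hf) as [d0 [Hd0 H0]].
  destruct (Hf (eps / 2 / (Cmod (g z) + 1))) as [d1 [Hd1 H1]].
  { apply Rdiv_lt_0_compat; lra. }
  destruct (Hg (eps / 2 / (Cmod (f z) + 1))) as [d2 [Hd2 H2]].
  { apply Rdiv_lt_0_compat; lra. }
  exists (Rmin d0 (Rmin d1 d2)); split; [repeat apply Rmin_glb_lt; auto|].
  intros w Hw.
  assert (Hw' := Rlt_le_trans _ _ _ Hw (Rmin_r _ _)).
  specialize (H0 w (Rlt_le_trans _ _ _ Hw (Rmin_l _ _))).
  specialize (H1 w (Rlt_le_trans _ _ _ Hw' (Rmin_l _ _))).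
  specialize (H2 w (Rlt_le_trans _ _ _ Hw' (Rmin_r _ _))).
  replace (f w * g w - f z * g z)%C
    with (f w * (g w - g z) + (f w - f z) * g z)%C by ring.
  eapply Rle_lt_trans; [apply Cmod_triangle|]. rewrite !Cmod_mult.
  assert (Cmod (f w) * Cmod (g w - g z) <= eps / 2).
  { replace (eps / 2) with ((Cmod (f z) + 1) * (eps / 2 / (Cmod (f z) + 1)))
      by (field; lra).
    apply Rmult_le_compat; try apply Cmod_ge_0; lra. }
  assert (Cmod (f w - f z) * Cmod (g z) < eps / 2).
  { apply Rle_lt_trans with (Cmod (g z) * (eps / 2 / (Cmod (g z) + 1))).
    - rewrite Rmult_comm; apply Rmult_le_compat_l; lra.
    - replace (eps / 2) with ((Cmod (g z) + 1) * (eps / 2 / (Cmod (g z) + 1)))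
        at 2 by (field; lra).
      apply Rmult_lt_compat_r; [apply Rdiv_lt_0_compat|]; lra. }
  lra.
Qed.

Lemma cont_at_comp (f g : C -> C) (z : C) :
  cont_at g z -> cont_at f (g z) -> cont_at (fun w => f (g w)) z.
Proof.
  intros Hg Hf eps He.
  destruct (Hf eps He) as [d1 [Hd1 H1]]; destruct (Hg d1 Hd1) as [d [Hd H]].
  exists d; split; auto.
Qed.

Lemma cont_at_inv (z : C) : z <> RtoC 0 -> cont_at Cinv z.
Proof.
  intros Hz eps He.
  assert (Pz : 0 < Cmod z) by (apply Cmod_gt_0; auto).
  (* The first radius keeps |w| above |z| / 2; the second then makes |w - z| / (|w| |z|) smaller
     than [eps]. *)
  exists (Rmin (Cmod z / 2) (eps * (Cmod z * Cmod z) / 2)).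
  assert (0 < eps * (Cmod z * Cmod z)) by (repeat apply Rmult_lt_0_compat; lra).
  split; [apply Rmin_glb_lt; lra|]; intros w Hw.
  assert (H1 := Rlt_le_trans _ _ _ Hw (Rmin_l _ _)).
  assert (H2 := Rlt_le_trans _ _ _ Hw (Rmin_r _ _)).
  assert (Hwz : Cmod z / 2 < Cmod w).
  { pose proof (Cmod_rev_triangle z w); rewrite Cmod_minus_sym in H1; lra. }
  assert (w <> RtoC 0) by (apply Cmod_gt_0; lra).
  replace (/ w - / z)%C with ((z - w) / (w * z))%C by (field; auto).
  rewrite Cmod_div, Cmod_mult, (Cmod_minus_sym z) by (apply Cmult_neq_0; auto).
  apply Rmult_lt_reg_r with (Cmod w * Cmod z); [nra|].
  unfold Rdiv; rewrite Rmult_assoc, Rinv_l, Rmult_1_r by nra.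
  apply Rlt_le_trans with (1 := H2).
  assert (0 < eps * Cmod z) by (apply Rmult_lt_0_compat; lra). nra.
Qed.

Lemma cont_at_inv_fun (f : C -> C) (z : C) :
  cont_at f z -> f z <> RtoC 0 -> cont_at (fun w => / f w)%C z.
Proof. intros Hf Hz; apply (cont_at_comp Cinv f); auto using cont_at_inv. Qed.

Lemma cont_at_ext_loc (f g : C -> C) (z : C) (d : R) :
  0 < d -> (forall w, Cmod (w - z) < d -> f w = g w) ->
  cont_at f z -> cont_at g z.
Proof.
  intros Hd Hfg Hf eps He; destruct (Hf eps He) as [d1 [Hd1 H1]].
  exists (Rmin d d1); split; [apply Rmin_glb_lt; auto|]; intros w Hw.
  rewrite <- !Hfg.
  - apply H1, Rlt_le_trans with (1 := Hw), Rmin_r.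
  - replace (z - z)%C with (RtoC 0) by ring; rewrite Cmod_0; auto.
  - apply Rlt_le_trans with (1 := Hw), Rmin_l.
Qed.

Lemma cderiv_cont (f : C -> C) (z l : C) : cderiv f z l -> cont_at f z.
Proof.
  intros [q [Hq [_ [d [Hd H]]]]].
  apply cont_at_ext_loc with (f := fun w => (f z + q w * (w + - z))%C) (d := d);
    auto.
  - intros w Hw. specialize (H w Hw).
    replace (f w) with (f w - f z + f z)%C by ring; rewrite H; ring.
  - apply cont_at_plus; [apply cont_at_const|].
    apply cont_at_mult; auto.
    apply cont_at_plus; [apply cont_at_id|apply cont_at_const].
Qed.

Lemma cderiv_ext_loc (f g : C -> C) (z l : C) (d : R) :
  0 < d -> (forall w, Cmod (w - z) < d -> f w = g w) ->
  cderiv f z l -> cderiv g z l.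
Proof.
  intros Hd Hfg [q [Hq [E [d1 [Hd1 H]]]]]; exists q; split; [|split]; auto.
  exists (Rmin d d1); split; [apply Rmin_glb_lt; auto|]; intros w Hw.
  rewrite <- !Hfg.
  - apply H, Rlt_le_trans with (1 := Hw), Rmin_r.
  - replace (z - z)%C with (RtoC 0) by ring; rewrite Cmod_0; auto.
  - apply Rlt_le_trans with (1 := Hw), Rmin_l.
Qed.

Lemma cderiv_ext (f g : C -> C) (z l : C) :
  (forall w, f w = g w) -> cderiv f z l -> cderiv g z l.
Proof. intros H; apply cderiv_ext_loc with 1; auto; lra. Qed.

Lemma cderiv_eq (f : C -> C) (z l l' : C) :
  cderiv f z l -> l = l' -> cderiv f z l'.
Proof. intros H <-; exact H. Qed.

Lemma cderiv_const (c z : C) : cderiv (fun _ => c) z 0.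
Proof.
  exists (fun _ => RtoC 0); split; [apply cont_at_const|split; auto].
  exists 1; split; [lra|]; intros; ring.
Qed.

Lemma cderiv_id (z : C) : cderiv (fun w => w) z 1.
Proof.
  exists (fun _ => RtoC 1); split; [apply cont_at_const|split; auto].
  exists 1; split; [lra|]; intros; ring.
Qed.

Lemma cderiv_plus (f g : C -> C) (z l m : C) :
  cderiv f z l -> cderiv g z m -> cderiv (fun w => f w + g w)%C z (l + m)%C.
Proof.
  intros [q [Hq [E [d [Hd H]]]]] [p [Hp [E' [d' [Hd' H']]]]].
  exists (fun w => q w + p w)%C; split; [apply cont_at_plus; auto|].
  split; [congruence|].
  exists (Rmin d d'); split; [apply Rmin_glb_lt; auto|]; intros w Hw.
  specialize (H w (Rlt_le_trans _ _ _ Hw (Rmin_l _ _))).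
  specialize (H' w (Rlt_le_trans _ _ _ Hw (Rmin_r _ _))).
  rewrite Cmult_plus_distr_r, <- H, <- H'; ring.
Qed.

Lemma cderiv_mult (f g : C -> C) (z l m : C) :
  cderiv f z l -> cderiv g z m ->
  cderiv (fun w => f w * g w)%C z (l * g z + f z * m)%C.
Proof.
  intros Hf Hg; pose proof (cderiv_cont _ _ _ Hg) as Cg; revert Hf Hg.
  intros [q [Hq [E [d [Hd H]]]]] [p [Hp [E' [d' [Hd' H']]]]].
  exists (fun w => q w * g w + f z * p w)%C; split; [|split; [congruence|]].
  { apply cont_at_plus; apply cont_at_mult; auto using cont_at_const. }
  exists (Rmin d d'); split; [apply Rmin_glb_lt; auto|]; intros w Hw.
  specialize (H w (Rlt_le_trans _ _ _ Hw (Rmin_l _ _))).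
  specialize (H' w (Rlt_le_trans _ _ _ Hw (Rmin_r _ _))).
  replace ((q w * g w + f z * p w) * (w - z))%C
    with (g w * (q w * (w - z)) + f z * (p w * (w - z)))%C by ring.
  rewrite <- H, <- H'; ring.
Qed.

Lemma cderiv_comp (f g : C -> C) (z l m : C) :
  cderiv f (g z) l -> cderiv g z m ->
  cderiv (fun w => f (g w)) z (l * m)%C.
Proof.
  intros Hf Hg; pose proof (cderiv_cont _ _ _ Hg) as Cg; revert Hf Hg.
  intros [q [Hq [E [d [Hd H]]]]] [p [Hp [E' [d' [Hd' H']]]]].
  exists (fun w => q (g w) * p w)%C; split; [|split; [congruence|]].
  { apply cont_at_mult; auto. apply cont_at_comp; auto. }
  destruct (Cg d Hd) as [d2 [Hd2 H2]].
  exists (Rmin d2 d'); split; [apply Rmin_glb_lt; auto|]; intros w Hw.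
  rewrite (H (g w)).
  - rewrite (H' w); [ring|]. apply Rlt_le_trans with (1 := Hw), Rmin_r.
  - apply H2, Rlt_le_trans with (1 := Hw), Rmin_l.
Qed.

Lemma cderiv_inv (z : C) : z <> RtoC 0 -> cderiv Cinv z (- / (z * z))%C.
Proof.
  intros Hz; exists (fun w => - RtoC 1 * (/ w * / z))%C; split; [|split].
  - repeat apply cont_at_mult; auto using cont_at_const, cont_at_inv.
  - field; auto.
  - assert (Pz : 0 < Cmod z) by (apply Cmod_gt_0; auto).
    exists (Cmod z); split; auto; intros w Hw.
    assert (w <> RtoC 0).
    { intros ->. replace (0 - z)%C with (- z)%C in Hw by ring.
      rewrite Cmod_opp in Hw; lra. }
    field; auto.
Qed.

Lemma cderiv_affine (a b z : C) : cderiv (fun w => a * w + b)%C z a.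
Proof.
  exists (fun _ => a); split; [apply cont_at_const|split; auto].
  exists 1; split; [lra|]; intros; ring.
Qed.

(** The first-order error form serves for real derivatives along lines, for [is_derive] and for
    limits of functions; [error_cderiv] is the way back. *)
Lemma cderiv_error (f : C -> C) (z l : C) :
  cderiv f z l -> forall eps, 0 < eps -> exists d, 0 < d /\
    forall w, Cmod (w - z) < d ->
      Cmod (f w - f z - l * (w - z)) <= eps * Cmod (w - z).
Proof.
  intros [q [Hq [E [d [Hd H]]]]] eps He.
  destruct (Hq eps He) as [d1 [Hd1 H1]].
  exists (Rmin d d1); split; [apply Rmin_glb_lt; auto|]; intros w Hw.
  rewrite H by (apply Rlt_le_trans with (1 := Hw), Rmin_l).
  rewrite <- E.
  replace (q w * (w - z) - q z * (w - z))%C with ((q w - q z) * (w - z))%C by ring.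
  rewrite Cmod_mult; apply Rmult_le_compat_r; [apply Cmod_ge_0|].
  apply Rlt_le, H1, Rlt_le_trans with (1 := Hw), Rmin_r.
Qed.

Lemma error_cderiv (f : C -> C) (z l : C) :
  (forall eps, 0 < eps -> exists d, 0 < d /\
    forall w, Cmod (w - z) < d ->
      Cmod (f w - f z - l * (w - z)) <= eps * Cmod (w - z)) ->
  cderiv f z l.
Proof.
  intros Hf.
  exists (fun w => if Req_EM_T (Cmod (w - z)) 0 then l
                   else ((f w - f z) / (w - z))%C).
  assert (E0 : Cmod (z - z) = 0).
  { replace (z - z)%C with (RtoC 0) by ring; apply Cmod_0. }
  split; [|split].
  - intros eps He; destruct (Hf (eps / 2) ltac:(lra)) as [d [Hd H]].
    exists d; split; auto; intros w Hw.
    destruct (Req_EM_T (Cmod (z - z)) 0) as [_|N]; [|contradiction].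
    destruct (Req_EM_T (Cmod (w - z)) 0) as [Ez|Nz].
    + replace (l - l)%C with (RtoC 0) by ring; rewrite Cmod_0; auto.
    + assert (Hz : (w - z)%C <> RtoC 0) by (intros E; rewrite E, Cmod_0 in Nz; auto).
      assert (P : 0 < Cmod (w - z)) by (apply Cmod_gt_0; auto).
      replace ((f w - f z) / (w - z) - l)%C
        with ((f w - f z - l * (w - z)) / (w - z))%C by (field; auto).
      rewrite Cmod_div by auto.
      apply Rle_lt_trans with (eps / 2); [|lra].
      apply Rmult_le_reg_r with (Cmod (w - z)); auto.
      unfold Rdiv at 1; rewrite Rmult_assoc, Rinv_l, Rmult_1_r by lra.
      apply H; auto.
  - destruct (Req_EM_T (Cmod (z - z)) 0); [auto|contradiction].
  - exists 1; split; [lra|]; intros w _.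
    destruct (Req_EM_T (Cmod (w - z)) 0) as [Ez|Nz].
    + apply Cmod_eq_0 in Ez.
      assert (w = z) as -> by (replace w with (w - z + z)%C by ring; rewrite Ez; ring).
      ring.
    + field. intros E; rewrite E, Cmod_0 in Nz; auto.
Qed.

(** With v = f b - f a, the real mean value theorem is applied along the segment to Re (conj v * f),
    whose total increment is exactly |v|^2; dividing by |v| gives the bound. *)
Lemma mean_value_inequality (f f' : C -> C) (a b : C) (K : R) :
  (forall t, 0 <= t <= 1 ->
     cderiv f (a + RtoC t * (b - a))%C (f' (a + RtoC t * (b - a))%C) /\
     Cmod (f' (a + RtoC t * (b - a))%C) <= K) ->
  Cmod (f b - f a) <= K * Cmod (b - a).
Proof.
  intros H. set (p := fun t : R => (a + RtoC t * (b - a))%C) in *.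
  set (v := (f b - f a)%C).
  set (phi := fun t => Re (Cconj v * f (p t))).
  destruct (MVT_cor2 phi (fun t => Re (Cconj v * (f' (p t) * (b - a)))) 0 1)
    as [c [Hc1 Hc2]]; [lra| |].
  - intros t Ht eps He. destruct (H t Ht) as [Hd _]. fold (p t) in Hd.
    (* The added ones keep [k] positive even when v = 0 or a = b. *)
    set (k := (Cmod v + 1) * (Cmod (b - a) + 1)).
    pose proof (Cmod_ge_0 v); pose proof (Cmod_ge_0 (b - a)).
    assert (Hk : 0 < k) by (apply Rmult_lt_0_compat; lra).
    destruct (cderiv_error _ _ _ Hd (eps / 2 / k)) as [d [Hdp Hdd]].
    { apply Rdiv_lt_0_compat; lra. }
    assert (Pd : 0 < d / (Cmod (b - a) + 1)) by (apply Rdiv_lt_0_compat; lra).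
    exists (mkposreal _ Pd); intros h Hh0 Hh; simpl in Hh.
    assert (Ep : (p (t + h)%R - p t = RtoC h * (b - a))%C).
    { unfold p; rewrite RtoC_plus; ring. }
    assert (Hp : Cmod (p (t + h)%R - p t) < d).
    { rewrite Ep, Cmod_mult, Cmod_R.
      apply Rle_lt_trans with (Rabs h * (Cmod (b - a) + 1)).
      - apply Rmult_le_compat_l; [apply Rabs_pos|lra].
      - apply Rmult_lt_reg_r with (/ (Cmod (b - a) + 1));
          [apply Rinv_0_lt_compat; lra|].
        rewrite Rmult_assoc, Rinv_r, Rmult_1_r by lra; auto. }
    specialize (Hdd _ Hp).
    replace ((phi (t + h) - phi t) / h - Re (Cconj v * (f' (p t) * (b - a))))
      with (Re (Cconj v * (f (p (t + h)%R) - f (p t) - f' (p t) * (p (t + h)%R - p t))) / h).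
    2: { rewrite Ep. unfold phi; simpl. field; auto. }
    unfold Rdiv; rewrite Rabs_mult, Rabs_inv.
    assert (Ph : 0 < Rabs h) by (apply Rabs_pos_lt; auto).
    apply Rle_lt_trans with (eps / 2); [|lra].
    apply Rmult_le_reg_r with (Rabs h); auto.
    rewrite Rmult_assoc, Rinv_l, Rmult_1_r by lra.
    eapply Rle_trans; [apply re_le_Cmod|].
    rewrite Cmod_mult, Cmod_conj.
    rewrite Ep, Cmod_mult, Cmod_R in Hdd. rewrite Ep.
    apply Rle_trans with (Cmod v * (eps / 2 / k * (Rabs h * Cmod (b - a)))).
    { apply Rmult_le_compat_l; auto. }
    replace (Cmod v * (eps / 2 / k * (Rabs h * Cmod (b - a))))
      with (eps / 2 * Rabs h * ((Cmod v * Cmod (b - a)) / k)) by (field; lra).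
    rewrite <- (Rmult_1_r (eps / 2 * Rabs h)) at 2.
    apply Rmult_le_compat_l; [nra|].
    apply Rmult_le_reg_r with k; auto.
    unfold Rdiv; rewrite Rmult_assoc, Rinv_l by lra. unfold k; nra.
  - assert (E0 : p 0 = a) by (unfold p; ring).
    assert (E1 : p 1 = b) by (unfold p; ring).
    assert (E : phi 1 - phi 0 = Cmod v * Cmod v).
    { unfold phi; rewrite E0, E1.
      pose proof (Cmod2_alt v) as E2; replace (Cmod v * Cmod v) with (Cmod v ^ 2) by ring.
      rewrite E2; unfold v; simpl; ring. }
    rewrite E, Rminus_0_r, Rmult_1_r in Hc1.
    destruct (H c ltac:(lra)) as [_ Hb]. fold (p c) in Hb.
    pose proof (Cmod_ge_0 v) as Pv. pose proof (Cmod_ge_0 (b - a)) as Pb.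
    assert (Hle : Cmod v * Cmod v <= Cmod v * (K * Cmod (b - a))).
    { rewrite Hc1. eapply Rle_trans; [apply Rle_abs|].
      eapply Rle_trans; [apply re_le_Cmod|].
      rewrite !Cmod_mult, Cmod_conj. apply Rmult_le_compat_l; auto.
      apply Rmult_le_compat_r; auto. }
    destruct (Req_dec (Cmod v) 0) as [Z|N].
    + rewrite Z. pose proof (Cmod_ge_0 (f' (p c))). apply Rmult_le_pos; lra.
    + apply Rmult_le_reg_l with (Cmod v); [lra|auto].
Qed.

(** * The exponential and uniform limits *)

Lemma Cexp_plus (a b : C) : Cexp (a + b) = (Cexp a * Cexp b)%C.
Proof.
  unfold Cexp, Cmult, Re, Im; simpl; rewrite exp_plus, cos_plus, sin_plus; f_equal; ring.
Qed.

Lemma Cmod_Cexp (z : C) : Cmod (Cexp z) = exp (Re z).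
Proof.
  destruct z as [a b]; unfold Cmod, Cexp, Re, Im; simpl fst; simpl snd.
  transitivity (sqrt (exp a ^ 2));
    [f_equal|apply sqrt_pow2, Rlt_le, exp_pos].
  pose proof (sin2_cos2 b) as E; unfold Rsqr in E.
  transitivity (exp a ^ 2 * (sin b * sin b + cos b * cos b)); [ring|].
  rewrite E; ring.
Qed.

Lemma Cexp_neq_0 (z : C) : Cexp z <> RtoC 0.
Proof. apply Cmod_gt_0; rewrite Cmod_Cexp; apply exp_pos. Qed.

(** From exp (-a) >= 1 - a one gets (1 - a) exp a <= 1, hence (1 - a) (exp a - 1 - a) <= a^2, and 1
    - a >= 1/2. *)
Lemma exp_minus_1_minus_id_bound (a : R) :
  Rabs a <= 1 / 2 -> Rabs (exp a - 1 - a) <= 2 * a ^ 2.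
Proof.
  intros Ha; apply Rabs_le_between in Ha.
  pose proof (exp_ineq1_le a) as H1; pose proof (exp_ineq1_le (- a)) as H2.
  rewrite exp_Ropp in H2. pose proof (exp_pos a) as P.
  assert (H3 : (1 - a) * exp a <= 1).
  { apply Rle_trans with (/ exp a * exp a); [|rewrite Rinv_l; lra].
    apply Rmult_le_compat_r; lra. }
  rewrite Rabs_pos_eq by lra.
  assert (a * (exp a - 1 - a) <= 1 / 2 * (exp a - 1 - a))
    by (apply Rmult_le_compat_r; lra).
  nra.
Qed.

Lemma one_minus_cos_bound (b : R) : 0 <= 1 - cos b <= b ^ 2 / 2.
Proof.
  pose proof (COS_bound b). split; [lra|].
  replace b with (2 * (b / 2)) at 1 by field.
  rewrite cos_2a_sin.
  assert (H2 : Rabs (sin (b / 2)) <= Rabs (b / 2)).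
  { destruct (Rtotal_order (b / 2) 0) as [L|[E|G]].
    - rewrite <- (Rabs_Ropp (b / 2)), <- Rabs_Ropp, <- sin_neg.
      apply Rabs_le; split.
      + pose proof (SIN_bound (- (b / 2))).
        destruct (Rle_dec (- (b / 2)) PI).
        * assert (0 <= sin (- (b / 2))) by (apply sin_ge_0; lra).
          rewrite Rabs_pos_eq by lra; lra.
        * rewrite Rabs_pos_eq by lra; pose proof PI2_1; lra.
      + rewrite Rabs_pos_eq by lra. apply Rlt_le, sin_lt_x; lra.
    - rewrite E, sin_0; lra.
    - apply Rabs_le; split.
      + pose proof (SIN_bound (b / 2)).
        destruct (Rle_dec (b / 2) PI).
        * assert (0 <= sin (b / 2)) by (apply sin_ge_0; lra).
          rewrite Rabs_pos_eq by lra; lra.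
        * rewrite Rabs_pos_eq by lra; pose proof PI2_1; lra.
      + rewrite Rabs_pos_eq by lra. apply Rlt_le, sin_lt_x; lra. }
  apply Rsqr_le_abs_1 in H2; unfold Rsqr in H2. nra.
Qed.

Lemma sin_minus_id_bound (b : R) : Rabs b <= 1 -> Rabs (sin b - b) <= b ^ 2.
Proof.
  intros Hb.
  assert (H : Rabs ((sin b - b) - (sin 0 - 0)) <= b ^ 2 * Rabs (b - 0)).
  { destruct (MVT_abs (fun x => sin x - x) (fun x => cos x - 1) 0 b)
      as [c [Hc1 Hc2]].
    - intros c _; apply (derivable_pt_lim_minus sin id);
        [apply derivable_pt_lim_sin|apply derivable_pt_lim_id].
    - rewrite Hc1; apply Rmult_le_compat_r; [apply Rabs_pos|].
      rewrite Rabs_minus_sym. pose proof (one_minus_cos_bound c).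
      rewrite Rabs_pos_eq by lra.
      assert (c ^ 2 <= b ^ 2).
      { revert Hc2; unfold Rmin, Rmax; destruct (Rle_dec 0 b); intros; nra. }
      nra. }
  rewrite sin_0, !Rminus_0_r in H.
  pose proof (pow2_ge_0 b); pose proof (Rabs_pos b). nra.
Qed.

(** For h = a + i b the two components are at most 2 a^2 + b^2 and 4 a^2 + 4 b^2; 10 is a round
    constant above their sum. *)
Lemma Cexp_minus_1_minus_id_bound (h : C) :
  Cmod h <= 1 / 2 -> Cmod (Cexp h - 1 - h) <= 10 * Cmod h ^ 2.
Proof.
  intros Hh. pose proof (Cmod2_alt h) as E.
  pose proof (re_le_Cmod h) as Ha; pose proof (im_le_Cmod h) as Hb.
  eapply Rle_trans; [apply Cmod_le_re_im|].
  destruct h as [a b]; unfold Cexp; simpl in *.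
  assert (Ha' : Rabs a <= 1 / 2) by lra. assert (Hb' : Rabs b <= 1 / 2) by lra.
  pose proof (exp_minus_1_minus_id_bound a Ha') as H1.
  pose proof (one_minus_cos_bound b) as H2.
  pose proof (sin_minus_id_bound b ltac:(lra)) as H3.
  apply Rabs_le_between in Ha', Hb', H1, H3.
  assert (He : 0 < exp a <= 2) by (split; [apply exp_pos|nra]).
  assert (Q1 : Rabs (exp a * cos b + - (1) + - a) <= 2 * a ^ 2 + b ^ 2).
  { apply Rabs_le; nra. }
  assert (Q2 : Rabs (exp a * sin b + - 0 + - b) <= 4 * b ^ 2 + 4 * a ^ 2).
  { assert (- (2 * b ^ 2) <= exp a * (sin b - b) <= 2 * b ^ 2) by (split; nra).
    assert (- (2 * a ^ 2) <= (exp a - 1 - a) * b <= 2 * a ^ 2) by (split; nra).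
    assert (- (a ^ 2 + b ^ 2) <= a * b <= a ^ 2 + b ^ 2) by (split; nra).
    replace (exp a * sin b + - 0 + - b)
      with (exp a * (sin b - b) + (exp a - 1 - a) * b + a * b) by ring.
    apply Rabs_le; lra. }
  nra.
Qed.

Lemma cderiv_Cexp (z : C) : cderiv Cexp z (Cexp z).
Proof.
  apply error_cderiv; intros eps He.
  set (k := 10 * (Cmod (Cexp z) + 1)).
  assert (Hk : 0 < k) by (unfold k; pose proof (Cmod_ge_0 (Cexp z)); lra).
  exists (Rmin (1 / 2) (eps / k)); split.
  { apply Rmin_glb_lt; [lra|apply Rdiv_lt_0_compat; auto]. }
  intros w Hw.
  assert (H1 := Rlt_le_trans _ _ _ Hw (Rmin_l _ _)).
  assert (H2 := Rlt_le_trans _ _ _ Hw (Rmin_r _ _)).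
  replace (Cexp w) with (Cexp z * Cexp (w - z))%C
    by (rewrite <- Cexp_plus; f_equal; ring).
  replace (Cexp z * Cexp (w - z) - Cexp z - Cexp z * (w - z))%C
    with (Cexp z * (Cexp (w - z) - 1 - (w - z)))%C by ring.
  rewrite Cmod_mult.
  pose proof (Cexp_minus_1_minus_id_bound (w - z) ltac:(lra)) as H3.
  pose proof (Cmod_ge_0 (w - z)) as P. pose proof (Cmod_ge_0 (Cexp z)) as P'.
  assert (H4 : k * Cmod (w - z) <= eps).
  { apply Rlt_le, Rmult_lt_reg_r with (/ k); [apply Rinv_0_lt_compat; auto|].
    replace (k * Cmod (w - z) * / k) with (Cmod (w - z)) by (field; lra); auto. }
  apply Rle_trans with (Cmod (Cexp z) * (10 * Cmod (w - z) ^ 2)).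
  - apply Rmult_le_compat_l; auto.
  - unfold k in H4. nra.
Qed.

(** * Complex limits and sequences with steps of order 1/n^2 *)

Definition clim (u : nat -> C) (l : C) : Prop :=
  forall eps, 0 < eps -> exists N, forall n, (N <= n)%nat -> Cmod (u n - l) < eps.

Lemma clim_re (u : nat -> C) (l : C) :
  clim u l -> is_lim_seq (fun n => Re (u n)) (Re l).
Proof.
  intros H; apply is_lim_seq_spec; intros eps.
  destruct (H eps (cond_pos eps)) as [N HN]; exists N; intros n Hn.
  eapply Rle_lt_trans; [|apply (HN n Hn)].
  replace (Re (u n) - Re l) with (Re (u n - l)) by reflexivity.
  apply re_le_Cmod.
Qed.

Lemma clim_im (u : nat -> C) (l : C) :
  clim u l -> is_lim_seq (fun n => Im (u n)) (Im l).
Proof.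
  intros H; apply is_lim_seq_spec; intros eps.
  destruct (H eps (cond_pos eps)) as [N HN]; exists N; intros n Hn.
  eapply Rle_lt_trans; [|apply (HN n Hn)].
  replace (Im (u n) - Im l) with (Im (u n - l)) by reflexivity.
  apply im_le_Cmod.
Qed.

Lemma clim_of_re_im (u : nat -> C) (l : C) :
  is_lim_seq (fun n => Re (u n)) (Re l) ->
  is_lim_seq (fun n => Im (u n)) (Im l) -> clim u l.
Proof.
  intros H1 H2 eps He.
  apply is_lim_seq_spec in H1; apply is_lim_seq_spec in H2.
  assert (He2 : 0 < eps / 2) by lra.
  destruct (H1 (mkposreal _ He2)) as [N1 HN1].
  destruct (H2 (mkposreal _ He2)) as [N2 HN2].
  exists (max N1 N2); intros n Hn.
  specialize (HN1 n ltac:(lia)); specialize (HN2 n ltac:(lia)); simpl in HN1, HN2.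
  eapply Rle_lt_trans; [apply Cmod_le_re_im|].
  unfold Re, Im in *; simpl in *; unfold Rminus in *; lra.
Qed.

Lemma clim_mult (u v : nat -> C) (l m : C) :
  clim u l -> clim v m -> clim (fun n => u n * v n)%C (l * m)%C.
Proof.
  intros Hu Hv.
  pose proof (clim_re _ _ Hu); pose proof (clim_im _ _ Hu).
  pose proof (clim_re _ _ Hv); pose proof (clim_im _ _ Hv).
  apply clim_of_re_im; simpl.
  - apply is_lim_seq_minus'; apply is_lim_seq_mult'; auto.
  - apply is_lim_seq_plus'; apply is_lim_seq_mult'; auto.
Qed.

Lemma clim_Cmod_le (u : nat -> C) (l c : C) (K : R) (N : nat) :
  clim u l -> (forall n, (N <= n)%nat -> Cmod (u n - c) <= K) ->
  Cmod (l - c) <= K.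
Proof.
  intros Hu H; apply le_epsilon; intros eps He.
  destruct (Hu eps He) as [N1 HN1].
  specialize (HN1 (max N N1) ltac:(lia)); specialize (H (max N N1) ltac:(lia)).
  replace (l - c)%C with (- (u (max N N1) - l) + (u (max N N1) - c))%C by ring.
  eapply Rle_trans; [apply Cmod_triangle|]. rewrite Cmod_opp; lra.
Qed.

(** The bound K / (n (n + 1)) is written as a difference so that sums of steps telescope to a tail
    of at most K / n. *)
Definition slow_steps (u : nat -> C) (K : R) (N : nat) : Prop :=
  forall n, (N <= n)%nat -> Cmod (u (S n) - u n) <= K * (/ INR n - / INR (S n)).

Lemma slow_steps_telescope (u : nat -> C) (K : R) (N n m : nat) :
  slow_steps u K N -> (N <= n)%nat -> (n <= m)%nat ->
  Cmod (u m - u n) <= K * (/ INR n - / INR m).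
Proof.
  intros H Hn Hm; induction Hm as [|m Hm IH].
  - replace (u n - u n)%C with (RtoC 0) by ring; rewrite Cmod_0; lra.
  - replace (u (S m) - u n)%C with ((u (S m) - u m) + (u m - u n))%C by ring.
    eapply Rle_trans; [apply Cmod_triangle|]. specialize (H m ltac:(lia)). lra.
Qed.

Lemma slow_steps_tail (u : nat -> C) (K : R) (N n m : nat) :
  0 <= K -> (1 <= N)%nat -> slow_steps u K N -> (N <= n)%nat -> (n <= m)%nat ->
  Cmod (u m - u n) <= K / INR n.
Proof.
  intros HK HN H Hn Hm.
  eapply Rle_trans; [apply (slow_steps_telescope u K N n m); auto|].
  apply Rmult_le_compat_l; auto.
  assert (0 < / INR m) by (apply Rinv_0_lt_compat, lt_0_INR; lia). lra.
Qed.

Lemma INR_inv_small (K eps : R) :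
  0 <= K -> 0 < eps -> exists N, (1 <= N)%nat /\
    forall n, (N <= n)%nat -> K / INR n < eps.
Proof.
  intros HK He. destruct (INR_unbounded (K / eps)) as [N HN].
  exists (S N); split; [lia|]; intros n Hn.
  assert (INR N < INR n) by (apply lt_INR; lia).
  pose proof (pos_INR N).
  apply Rmult_lt_reg_r with (INR n); [lra|].
  unfold Rdiv; rewrite Rmult_assoc, Rinv_l, Rmult_1_r by lra.
  replace K with (eps * (K / eps)) by (field; lra).
  apply Rmult_lt_compat_l; lra.
Qed.

Lemma slow_steps_clim (u : nat -> C) (K : R) (N : nat) :
  0 <= K -> (1 <= N)%nat -> slow_steps u K N -> exists l, clim u l.
Proof.
  intros HK HN H.
  assert (HC : forall p : C -> R,
    (forall a b, Rabs (p a - p b) <= Cmod (a - b)) ->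
    exists l : R, is_lim_seq (fun n => p (u n)) l).
  { intros p Hp.
    assert (E : ex_finite_lim_seq (fun n => p (u n))).
    { apply ex_lim_seq_cauchy_corr; intros eps.
      destruct (INR_inv_small (2 * K) eps ltac:(lra) (cond_pos eps)) as [N1 [_ HN1]].
      exists (max N N1); intros n m Hn Hm.
      specialize (HN1 (max N N1) ltac:(lia)).
      eapply Rle_lt_trans; [apply Hp|]. eapply Rle_lt_trans; [|apply HN1].
      pose proof (slow_steps_tail u K N (max N N1) n HK HN H ltac:(lia) Hn) as A.
      pose proof (slow_steps_tail u K N (max N N1) m HK HN H ltac:(lia) Hm) as B.
      rewrite Cmod_minus_sym in B.
      replace (u n - u m)%C
        with ((u n - u (max N N1)) + (u (max N N1) - u m))%C by ring.
      eapply Rle_trans; [apply Cmod_triangle|].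
      unfold Rdiv in *; lra. }
    destruct E as [l El]; exists l; auto. }
  destruct (HC Re) as [a Ha].
  { intros x y; replace (Re x - Re y) with (Re (x - y)) by reflexivity.
    apply re_le_Cmod. }
  destruct (HC Im) as [b Hb].
  { intros x y; replace (Im x - Im y) with (Im (x - y)) by reflexivity.
    apply im_le_Cmod. }
  exists (a, b); apply clim_of_re_im; auto.
Qed.

(** The error of F is split into three parts: the increment of F - f_n, the error of f_n at fixed n,
    and (f'_n - l) (w - z0). Since [K] and [N] do not depend on w, the first and third are at most
    (K / n) |w - z0|. *)
Lemma cderiv_limit (f f' : nat -> C -> C) (F : C -> C) (z0 l : C)
    (r K : R) (N : nat) :
  0 < r -> 0 <= K -> (1 <= N)%nat ->
  (forall n w, (N <= n)%nat -> Cmod (w - z0) < r -> cderiv (f n) w (f' n w)) ->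
  (forall w, Cmod (w - z0) < r -> slow_steps (fun n => f' n w) K N) ->
  (forall w, Cmod (w - z0) < r -> clim (fun n => f n w) (F w)) ->
  clim (fun n => f' n z0) l ->
  cderiv F z0 l.
Proof.
  intros Hr HK HN Hd Hs HF Hl; apply error_cderiv; intros eps He.
  destruct (INR_inv_small K (eps / 3) HK ltac:(lra)) as [N1 [_ HN1]].
  set (n := max N N1). specialize (HN1 n ltac:(lia)).
  assert (Hz : Cmod (z0 - z0) < r).
  { replace (z0 - z0)%C with (RtoC 0) by ring; rewrite Cmod_0; auto. }
  assert (Hl' : Cmod (l - f' n z0) <= K / INR n).
  { apply clim_Cmod_le with (fun m => f' m z0) n; auto.
    intros m Hm; apply (slow_steps_tail (fun m => f' m z0) K N n m); auto; lia. }
  destruct (cderiv_error _ _ _ (Hd n z0 ltac:(lia) Hz) (eps / 3) ltac:(lra))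
    as [d [Hdp Hdd]].
  exists (Rmin r d); split; [apply Rmin_glb_lt; auto|]; intros w Hw.
  assert (Hw1 := Rlt_le_trans _ _ _ Hw (Rmin_l _ _)).
  specialize (Hdd w (Rlt_le_trans _ _ _ Hw (Rmin_r _ _))).
  (* The mean value inequality bounds the increment of f_m - f_n uniformly in m >= n; then m tends
     to infinity. *)
  assert (HD : Cmod ((F w - F z0) - (f n w - f n z0)) <= K / INR n * Cmod (w - z0)).
  { apply clim_Cmod_le with (fun m => (f m w - f m z0)%C) n.
    - intros e1 He1.
      destruct (HF w Hw1 (e1 / 2) ltac:(lra)) as [A HA].
      destruct (HF z0 Hz (e1 / 2) ltac:(lra)) as [B HB].
      exists (max A B); intros m Hm.
      specialize (HA m ltac:(lia)); specialize (HB m ltac:(lia)).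
      replace (f m w - f m z0 - (F w - F z0))%C
        with ((f m w - F w) + - (f m z0 - F z0))%C by ring.
      eapply Rle_lt_trans; [apply Cmod_triangle|]; rewrite Cmod_opp; lra.
    - intros m Hm.
      replace (f m w - f m z0 - (f n w - f n z0))%C
        with ((f m w + - RtoC 1 * f n w) - (f m z0 + - RtoC 1 * f n z0))%C by ring.
      apply (mean_value_inequality (fun x => (f m x + - RtoC 1 * f n x)%C)
               (fun x => (f' m x + - RtoC 1 * f' n x)%C)).
      intros t Ht. set (x := (z0 + RtoC t * (w - z0))%C).
      assert (Hx : Cmod (x - z0) < r).
      { unfold x; replace (z0 + RtoC t * (w - z0) - z0)%C
          with (RtoC t * (w - z0))%C by ring.
        rewrite Cmod_mult, Cmod_R, Rabs_pos_eq by lra.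
        pose proof (Cmod_ge_0 (w - z0)); nra. }
      split.
      + apply cderiv_plus; [apply Hd; auto; lia|].
        eapply cderiv_eq;
          [apply cderiv_mult; [apply cderiv_const|apply Hd; auto; lia]|cbv beta; ring].
      + replace (f' m x + - RtoC 1 * f' n x)%C with (f' m x - f' n x)%C by ring.
        apply (slow_steps_tail (fun m => f' m x) K N n m); auto; lia. }
  replace (F w - F z0 - l * (w - z0))%C
    with (((F w - F z0) - (f n w - f n z0)) +
          ((f n w - f n z0 - f' n z0 * (w - z0)) + - (l - f' n z0) * (w - z0)))%C
    by ring.
  eapply Rle_trans; [apply Cmod_triangle|].
  apply Rle_trans with (K / INR n * Cmod (w - z0) +
    (eps / 3 * Cmod (w - z0) + K / INR n * Cmod (w - z0))).
  - apply Rplus_le_compat; auto.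
    eapply Rle_trans; [apply Cmod_triangle|]. apply Rplus_le_compat; auto.
    rewrite Cmod_mult, Cmod_opp. apply Rmult_le_compat_r; auto; apply Cmod_ge_0.
  - pose proof (Cmod_ge_0 (w - z0)). nra.
Qed.

(** * Holomorphy of Gamma *)

Fixpoint inv_sum (z : C) (n : nat) : C :=
  match n with
  | O => RtoC 0
  | S k => (inv_sum z k + / (z + RtoC (INR k)))%C
  end.

(** The logarithmic derivative of [gauss_term z n]; the index [S n] matches the n + 1 factors z,
    ..., z + n in its denominator. *)
Definition digamma_term (z : C) (n : nat) : C :=
  (RtoC (ln (INR n)) - inv_sum z (S n))%C.

Lemma shift_neq_0 (z : C) (x : R) : Im z <> 0 -> (z + RtoC x)%C <> RtoC 0.
Proof.
  intros Hz E; apply Hz.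
  apply (f_equal Im) in E; simpl in E. unfold Im in *; lra.
Qed.

Lemma rising_neq_0 (z : C) (n : nat) : Im z <> 0 -> rising z n <> RtoC 0.
Proof.
  intros Hz; induction n as [|n IH]; simpl; [apply C1_nz|].
  apply Cmult_neq_0; auto using shift_neq_0.
Qed.

Lemma cderiv_rising (z : C) (n : nat) :
  Im z <> 0 ->
  cderiv (fun w => rising w n) z (rising z n * inv_sum z n)%C.
Proof.
  intros Hz; induction n as [|n IH]; simpl.
  - eapply cderiv_eq; [apply cderiv_const|ring].
  - eapply cderiv_eq.
    + apply (cderiv_mult _ (fun w => (w + RtoC (INR n))%C)); [exact IH|].
      apply cderiv_plus; [apply cderiv_id|apply cderiv_const].
    + cbv beta; field. apply shift_neq_0; auto.
Qed.

Lemma cderiv_gauss_term (z : C) (n : nat) :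
  Im z <> 0 ->
  cderiv (fun w => gauss_term w n) z (gauss_term z n * digamma_term z n)%C.
Proof.
  intros Hz; unfold gauss_term, Rcpow, Cdiv.
  pose proof (rising_neq_0 z (S n) Hz) as Hr.
  eapply cderiv_eq.
  - apply cderiv_mult with
      (f := fun w => (RtoC (INR (fact n)) * Cexp (w * RtoC (ln (INR n))))%C)
      (g := fun w => (/ rising w (S n))%C).
    + apply cderiv_mult; [apply cderiv_const|].
      apply (cderiv_comp Cexp); [apply cderiv_Cexp|].
      apply cderiv_mult; [apply cderiv_id|apply cderiv_const].
    + apply (cderiv_comp Cinv); [apply cderiv_inv; auto|apply cderiv_rising; auto].
  - cbv beta; unfold digamma_term. field; auto.
Qed.

(** Both sides are ln x <= x - 1, taken at x = n / (n + 1) and at x = (n + 1) / n. *)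
Lemma ln_step_bound (n : nat) :
  (1 <= n)%nat ->
  / INR (S n) <= ln (INR (S n)) - ln (INR n) <= / INR n.
Proof.
  intros Hn. assert (P : 0 < INR n) by (apply lt_0_INR; lia).
  assert (P' : 0 < INR (S n)) by (apply lt_0_INR; lia).
  assert (E : INR (S n) = INR n + 1) by apply S_INR.
  assert (H : forall x, 0 < x -> ln x <= x - 1).
  { intros x Hx. pose proof (exp_ineq1_le (ln x)) as H; rewrite exp_ln in H; lra. }
  rewrite <- ln_div by auto.
  split.
  - assert (H1 := H (INR n / INR (S n)) ltac:(apply Rdiv_lt_0_compat; auto)).
    rewrite ln_div in * by auto.
    replace (INR n / INR (S n)) with (1 - / INR (S n)) in H1
      by (rewrite E in *; field; lra).
    lra.
  - assert (H1 := H (INR (S n) / INR n) ltac:(apply Rdiv_lt_0_compat; auto)).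
    replace (INR (S n) / INR n) with (1 + / INR n) in H1 at 2
      by (rewrite E in *; field; lra).
    lra.
Qed.

Lemma Cmod_shift_ge (z : C) (n : nat) (R0 : R) :
  Cmod z <= R0 -> 2 * R0 <= INR n -> INR (S n) / 2 <= Cmod (z + RtoC (INR (S n))).
Proof.
  intros Hz Hn. rewrite S_INR in *.
  pose proof (Cmod_rev_triangle (RtoC (INR n + 1)) (- z)) as H.
  rewrite Cmod_opp, Cmod_R in H.
  replace (RtoC (INR n + 1) - - z)%C with (z + RtoC (INR n + 1))%C in H by ring.
  pose proof (pos_INR n). rewrite Rabs_pos_eq in H by lra. lra.
Qed.

Lemma inv_INR_step (n : nat) :
  (1 <= n)%nat -> / INR n - / INR (S n) = / (INR n * INR (S n)).
Proof.
  intros Hn. assert (P : 0 < INR n) by (apply lt_0_INR; lia).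
  rewrite S_INR; field; lra.
Qed.

(** The step ln ((n + 1) / n) - 1 / (z + n + 1) is compared with 1 / (n + 1): one difference is at
    most 1 / n - 1 / (n + 1), the other is z / ((n + 1) (z + n + 1)), where |z + n + 1| >= (n + 1) /
    2. *)
Lemma digamma_term_step (z : C) (n : nat) (R0 : R) :
  Im z <> 0 -> Cmod z <= R0 -> (1 <= n)%nat -> 2 * R0 <= INR n ->
  Cmod (digamma_term z (S n) - digamma_term z n)
    <= (1 + 2 * R0) * (/ INR n - / INR (S n)).
Proof.
  intros Hi Hz Hn HR.
  pose proof (ln_step_bound n Hn) as Hl.
  pose proof (Cmod_shift_ge z n R0 Hz HR) as Hs.
  assert (P : 0 < INR n) by (apply lt_0_INR; lia).
  assert (P' : 0 < INR (S n)) by (apply lt_0_INR; lia).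
  pose proof (shift_neq_0 z (INR (S n)) Hi) as Hne.
  assert (Hne' : RtoC (INR (S n)) <> RtoC 0) by (intros E; apply RtoC_inj in E; lra).
  pose proof (Cmod_ge_0 z) as Pz.
  set (d := ln (INR (S n)) - ln (INR n)) in *.
  replace (digamma_term z (S n) - digamma_term z n)%C
    with (RtoC (d - / INR (S n)) + z / (RtoC (INR (S n)) * (z + RtoC (INR (S n)))))%C.
  2: { unfold digamma_term, d. cbn [inv_sum]. rewrite !RtoC_minus, RtoC_inv by lra.
       field; repeat split; auto using shift_neq_0. }
  eapply Rle_trans; [apply Cmod_triangle|].
  rewrite Cmod_R, Cmod_div, Cmod_mult, Cmod_R by (apply Cmult_neq_0; auto).
  rewrite (Rabs_pos_eq (INR (S n))), Rabs_pos_eq by lra.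
  rewrite Rmult_plus_distr_r, Rmult_1_l. apply Rplus_le_compat; [lra|].
  rewrite inv_INR_step by auto.
  assert (Hq : INR n * INR (S n) / 2 <= INR (S n) * Cmod (z + RtoC (INR (S n)))).
  { assert (INR n <= INR (S n)) by (apply le_INR; lia). nra. }
  assert (0 < INR n * INR (S n)) by nra.
  unfold Rdiv at 1. apply Rle_trans with (R0 * / (INR n * INR (S n) / 2)).
  - apply Rmult_le_compat; auto.
    + apply Rlt_le, Rinv_0_lt_compat; lra.
    + apply Rinv_le_contravar; lra.
  - apply Req_le; field; lra.
Qed.

(** With d = ln ((n + 1) / n) and h = z d, the ratio of consecutive terms is (n + 1) exp h / (z + n
    + 1). The first-order parts cancel, leaving (n + 1) (exp h - 1 - h) + z ((n + 1) d - 1) in the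
    numerator of [e]. The multiplicative form lets the terms be bounded as a product. *)
Lemma gauss_term_step (z : C) (n : nat) (R0 : R) :
  Im z <> 0 -> Cmod z <= R0 -> (1 <= n)%nat -> 2 * R0 <= INR n ->
  exists e : C, gauss_term z (S n) = (gauss_term z n * (1 + e))%C /\
    Cmod e <= (2 * R0 + 40 * R0 ^ 2) * (/ INR n - / INR (S n)).
Proof.
  intros Hi Hz Hn HR.
  pose proof (ln_step_bound n Hn) as Hl.
  pose proof (Cmod_shift_ge z n R0 Hz HR) as Hs.
  assert (P : 0 < INR n) by (apply lt_0_INR; lia).
  assert (P' : 0 < INR (S n)) by (apply lt_0_INR; lia).
  pose proof (shift_neq_0 z (INR (S n)) Hi) as Hne.
  pose proof (rising_neq_0 z (S n) Hi) as Hr.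
  pose proof (Cmod_ge_0 z) as Pz.
  set (d := ln (INR (S n)) - ln (INR n)) in *.
  set (h := (z * RtoC d)%C).
  assert (E1 : Cexp (z * RtoC (ln (INR (S n)))) =
               (Cexp (z * RtoC (ln (INR n))) * Cexp h)%C).
  { rewrite <- Cexp_plus; f_equal. unfold h, d; rewrite RtoC_minus; ring. }
  exists ((RtoC (INR (S n)) * Cexp h - (z + RtoC (INR (S n)))) /
     (z + RtoC (INR (S n))))%C.
  split.
  - unfold gauss_term, Rcpow. rewrite E1.
    change (fact (S n)) with (S n * fact n)%nat. rewrite mult_INR, RtoC_mult.
    change (rising z (S (S n))) with (rising z (S n) * (z + RtoC (INR (S n))))%C.
    field; auto.
  - assert (Hh : Cmod h <= R0 / INR n).
    { unfold h; rewrite Cmod_mult, Cmod_R, Rabs_pos_eq.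
      - apply Rmult_le_compat; auto; try lra.
        apply Rle_trans with (/ INR (S n)); [|lra].
        apply Rlt_le, Rinv_0_lt_compat; auto.
      - apply Rle_trans with (/ INR (S n)); [|lra].
        apply Rlt_le, Rinv_0_lt_compat; auto. }
    assert (Hh2 : R0 / INR n <= 1 / 2).
    { apply Rmult_le_reg_r with (INR n); auto. unfold Rdiv.
      rewrite Rmult_assoc, Rinv_l by lra; lra. }
    pose proof (Cexp_minus_1_minus_id_bound h ltac:(lra)) as He.
    pose proof (Cmod_ge_0 h) as Ph.
    replace (RtoC (INR (S n)) * Cexp h - (z + RtoC (INR (S n))))%C
      with (RtoC (INR (S n)) * (Cexp h - 1 - h) + z * RtoC (INR (S n) * d - 1))%C.
    2: { unfold h. rewrite RtoC_minus, RtoC_mult; ring. }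
    rewrite Cmod_div by auto.
    assert (Hd : 0 <= INR (S n) * d - 1 <= / INR n).
    { split.
      - apply Rle_trans with (INR (S n) * / INR (S n) - 1); [rewrite Rinv_r; lra|].
        apply Rplus_le_compat_r, Rmult_le_compat_l; lra.
      - apply Rle_trans with (INR (S n) * / INR n - 1).
        + apply Rplus_le_compat_r, Rmult_le_compat_l; lra.
        + rewrite S_INR; apply Req_le; field; lra. }
    assert (Hnum : Cmod (RtoC (INR (S n)) * (Cexp h - 1 - h) +
                         z * RtoC (INR (S n) * d - 1))
                   <= INR (S n) * (10 * (R0 / INR n) ^ 2) + R0 * / INR n).
    { eapply Rle_trans; [apply Cmod_triangle|].
      rewrite !Cmod_mult, !Cmod_R.
      rewrite (Rabs_pos_eq (INR (S n))), (Rabs_pos_eq (INR (S n) * d - 1)) by lra.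
      apply Rplus_le_compat.
      - apply Rmult_le_compat_l; [lra|]. eapply Rle_trans; [apply He|].
        apply Rmult_le_compat_l; [lra|]. apply pow_incr; lra.
      - apply Rmult_le_compat; lra. }
    rewrite inv_INR_step by auto.
    apply Rle_trans with
      ((INR (S n) * (10 * (R0 / INR n) ^ 2) + R0 * / INR n) * / (INR (S n) / 2)).
    + apply Rmult_le_compat; auto.
      * apply Cmod_ge_0.
      * apply Rlt_le, Rinv_0_lt_compat; lra.
      * apply Rinv_le_contravar; lra.
    + replace ((INR (S n) * (10 * (R0 / INR n) ^ 2) + R0 * / INR n) * / (INR (S n) / 2))
        with ((20 * R0 ^ 2 * (INR (S n) / INR n) + 2 * R0) / (INR n * INR (S n)))
        by (field; lra).
      assert (H1 : 1 <= INR n) by (apply (le_INR 1); auto).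
      assert (INR (S n) / INR n <= 2).
      { apply Rmult_le_reg_r with (INR n); auto. unfold Rdiv.
        rewrite Rmult_assoc, Rinv_l by lra. rewrite S_INR; lra. }
      apply Rmult_le_compat_r; [apply Rlt_le, Rinv_0_lt_compat; nra|].
      pose proof (pow2_ge_0 R0). nra.
Qed.

Lemma clim_CGamma_unique (z l : C) :
  clim (fun n => gauss_term z n) l -> CGamma z = l.
Proof.
  intros H; unfold CGamma.
  rewrite (is_lim_seq_unique _ _ (clim_re _ _ H)).
  rewrite (is_lim_seq_unique _ _ (clim_im _ _ H)).
  simpl; destruct l; reflexivity.
Qed.

(* Near [z0] the steps of both [gauss_term] and [digamma_term] are uniformly
   O(1/n^2), so the derivatives [gauss_term * digamma_term] converge uniformly. *)
Lemma cderiv_CGamma (z0 : C) :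
  Im z0 <> 0 ->
  exists psi : C, clim (fun n => digamma_term z0 n) psi /\
    cderiv CGamma z0 (CGamma z0 * psi)%C.
Proof.
  intros Hi.
  set (R0 := Cmod z0 + 1). pose proof (Cmod_ge_0 z0) as Pz.
  destruct (INR_unbounded (2 * R0)) as [N0 HN0].
  set (N := S N0).
  assert (HN : forall n, (N <= n)%nat -> (1 <= n)%nat /\ 2 * R0 <= INR n).
  { intros n Hn; split; [unfold N in *; lia|].
    apply Rle_trans with (INR N0); [lra|]. apply le_INR; unfold N in *; lia. }
  assert (HN1 : (1 <= N)%nat) by (unfold N; lia).
  set (K1 := 2 * R0 + 40 * R0 ^ 2). set (K2 := 1 + 2 * R0).
  assert (HR0 : 0 <= R0) by (unfold R0; lra).
  assert (HK1 : 0 <= K1) by (unfold K1; nra).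
  assert (HK2 : 0 <= K2) by (unfold K2; lra).
  destruct (cont_at_locally_bounded _ _
    (cderiv_cont _ _ _ (cderiv_gauss_term z0 N Hi))) as [r1 [Hr1 B1]].
  assert (C2 : cont_at (fun w => digamma_term w N) z0).
  { unfold digamma_term. apply cont_at_plus; [apply cont_at_const|].
    apply cont_at_ext_loc with (f := fun w => (- RtoC 1 * inv_sum w (S N))%C) (d := 1);
      [lra|intros; ring|].
    apply cont_at_mult; [apply cont_at_const|].
    generalize (S N); induction n as [|n IH]; simpl; [apply cont_at_const|].
    apply cont_at_plus; [exact IH|]. apply cont_at_inv_fun.
    - apply cont_at_plus; [apply cont_at_id|apply cont_at_const].
    - apply shift_neq_0; auto. }
  destruct (cont_at_locally_bounded _ _ C2) as [r2 [Hr2 B2]].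
  (* The ball of radius [r] avoids the real axis, stays in |w| <= [R0], and keeps both sequences
     bounded at the starting index [N]. *)
  set (r := Rmin (Rmin 1 (Rabs (Im z0))) (Rmin r1 r2)).
  assert (Hr : 0 < r).
  { repeat apply Rmin_glb_lt; auto; [lra|apply Rabs_pos_lt; auto]. }
  assert (HrA : r <= 1) by (unfold r; eapply Rle_trans; apply Rmin_l).
  assert (HrB : r <= Rabs (Im z0))
    by (unfold r; eapply Rle_trans; [apply Rmin_l|apply Rmin_r]).
  assert (HrC : r <= r1)
    by (unfold r; eapply Rle_trans; [apply Rmin_r|apply Rmin_l]).
  assert (HrD : r <= r2)
    by (unfold r; eapply Rle_trans; [apply Rmin_r|apply Rmin_r]).
  set (G0 := Cmod (gauss_term z0 N) + 1) in *.
  set (P0 := Cmod (digamma_term z0 N) + 1) in *.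
  assert (HG0 : 0 <= G0) by (unfold G0; pose proof (Cmod_ge_0 (gauss_term z0 N)); lra).
  assert (HP0 : 0 <= P0) by (unfold P0; pose proof (Cmod_ge_0 (digamma_term z0 N)); lra).
  set (G := G0 * exp (K1 / INR N)). set (Q := P0 + K2 / INR N).
  assert (PN : 0 < INR N) by (apply lt_0_INR; lia).
  assert (HKN : 0 <= K2 / INR N).
  { apply Rmult_le_pos; auto. apply Rlt_le, Rinv_0_lt_compat; auto. }
  assert (HG : 0 <= G) by (apply Rmult_le_pos; auto; apply Rlt_le, exp_pos).
  assert (Hball : forall w, Cmod (w - z0) < r ->
            Im w <> 0 /\ Cmod w <= R0 /\
            Cmod (gauss_term w N) <= G0 /\ Cmod (digamma_term w N) <= P0).
  { intros w Hw; split; [|split; [|split]].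
    - intros E. pose proof (im_le_Cmod (w - z0)) as H.
      replace (Im (w - z0)) with (Im w - Im z0) in H by reflexivity.
      rewrite E, Rminus_0_l, Rabs_Ropp in H. lra.
    - pose proof (Cmod_rev_triangle w z0). unfold R0; lra.
    - apply B1; lra.
    - apply B2; lra. }
  assert (Sdig : forall w, Cmod (w - z0) < r -> slow_steps (fun n => digamma_term w n) K2 N).
  { intros w Hw n Hn. destruct (Hball w Hw) as [A [B _]]. destruct (HN n Hn).
    apply digamma_term_step; auto. }
  assert (Bdig : forall w n, Cmod (w - z0) < r -> (N <= n)%nat -> Cmod (digamma_term w n) <= Q).
  { intros w n Hw Hn. destruct (Hball w Hw) as [_ [_ [_ D]]].
    pose proof (slow_steps_tail _ K2 N N n HK2 HN1 (Sdig w Hw) ltac:(lia) Hn) as T.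
    cbv beta in T. pose proof (Cmod_rev_triangle (digamma_term w n) (digamma_term w N)).
    unfold Q; lra. }
  assert (Bgau : forall w n, Cmod (w - z0) < r -> (N <= n)%nat -> Cmod (gauss_term w n) <= G).
  { intros w n Hw Hn. destruct (Hball w Hw) as [A [B [D _]]].
    (* Each factor satisfies 1 + |e| <= exp |e|, so the product of factors is at most the
       exponential of a telescoping sum. *)
    assert (T : Cmod (gauss_term w n) <= G0 * exp (K1 * (/ INR N - / INR n))).
    { induction Hn as [|n Hn IH].
      - rewrite Rminus_diag, Rmult_0_r, exp_0; lra.
      - destruct (HN n Hn) as [H1 H2].
        destruct (gauss_term_step w n R0 A B H1 H2) as [e [-> He]].
        rewrite Cmod_mult. fold K1 in He.
        replace (K1 * (/ INR N - / INR (S n))) with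
          (K1 * (/ INR N - / INR n) + K1 * (/ INR n - / INR (S n))) by ring.
        rewrite exp_plus, <- Rmult_assoc.
        apply Rmult_le_compat; auto using Cmod_ge_0.
        eapply Rle_trans; [apply Cmod_triangle|]. rewrite Cmod_1.
        eapply Rle_trans; [|apply exp_ineq1_le]. lra. }
    eapply Rle_trans; [apply T|]. apply Rmult_le_compat_l; auto.
    assert (0 < / INR n) by (apply Rinv_0_lt_compat, lt_0_INR; destruct (HN n Hn); lia).
    assert (Hle : K1 * (/ INR N - / INR n) <= K1 / INR N)
      by (unfold Rdiv; apply Rmult_le_compat_l; lra).
    destruct Hle as [L|E]; [apply Rlt_le, exp_increasing, L|rewrite E; lra]. }
  assert (Sgau : forall w, Cmod (w - z0) < r -> slow_steps (fun n => gauss_term w n) (G * K1) N).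
  { intros w Hw n Hn. destruct (Hball w Hw) as [A [B _]]. destruct (HN n Hn) as [H1 H2].
    destruct (gauss_term_step w n R0 A B H1 H2) as [e [-> He]].
    replace (gauss_term w n * (1 + e) - gauss_term w n)%C
      with (gauss_term w n * e)%C by ring.
    rewrite Cmod_mult, Rmult_assoc. apply Rmult_le_compat; auto using Cmod_ge_0. }
  assert (Hlim : forall w, Cmod (w - z0) < r -> clim (fun n => gauss_term w n) (CGamma w)).
  { intros w Hw.
    destruct (slow_steps_clim _ (G * K1) N ltac:(apply Rmult_le_pos; auto) HN1 (Sgau w Hw))
      as [l Hl].
    rewrite (clim_CGamma_unique _ _ Hl); auto. }
  assert (Hz0 : Cmod (z0 - z0) < r).
  { replace (z0 - z0)%C with (RtoC 0) by ring; rewrite Cmod_0; auto. }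
  destruct (slow_steps_clim _ K2 N HK2 HN1 (Sdig z0 Hz0)) as [psi Hpsi].
  exists psi; split; auto.
  apply cderiv_limit with
    (f := fun n w => gauss_term w n)
    (f' := fun n w => (gauss_term w n * digamma_term w n)%C)
    (r := r) (K := G * K1 * Q + G * K2) (N := N); auto.
  - assert (0 <= Q) by (unfold Q; lra).
    assert (0 <= G * K1) by (apply Rmult_le_pos; auto).
    assert (0 <= G * K1 * Q) by (apply Rmult_le_pos; auto).
    assert (0 <= G * K2) by (apply Rmult_le_pos; auto). lra.
  - intros n w Hn Hw; apply cderiv_gauss_term, Hball; auto.
  - intros w Hw n Hn.
    replace (gauss_term w (S n) * digamma_term w (S n) - gauss_term w n * digamma_term w n)%C
      with ((gauss_term w (S n) - gauss_term w n) * digamma_term w (S n) +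
            gauss_term w n * (digamma_term w (S n) - digamma_term w n))%C by ring.
    eapply Rle_trans; [apply Cmod_triangle|]. rewrite !Cmod_mult.
    replace ((G * K1 * Q + G * K2) * (/ INR n - / INR (S n)))
      with (G * K1 * (/ INR n - / INR (S n)) * Q + G * (K2 * (/ INR n - / INR (S n))))
      by ring.
    apply Rplus_le_compat.
    + apply Rmult_le_compat; auto using Cmod_ge_0. apply (Sgau w Hw n Hn).
    + apply Rmult_le_compat; auto using Cmod_ge_0. apply (Sdig w Hw n Hn).
  - apply clim_mult; auto.
Qed.

(** * The logarithmic derivative of chi *)

Definition Ccos (z : C) : C := ((Cexp (Ci * z) + Cexp (- (Ci * z))) / 2)%C.

Lemma RtoC_neq_0 (x : R) : x <> 0 -> RtoC x <> RtoC 0.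
Proof. intros H E; apply H, RtoC_inj, E. Qed.

Lemma cderiv_Csin (z : C) : cderiv Csin z (Ccos z).
Proof.
  unfold Csin, Ccos, Cdiv. pose proof (RtoC_neq_0 2 ltac:(lra)) as H2.
  pose proof Ci_nz.
  eapply cderiv_eq.
  - apply cderiv_mult with
      (f := fun w => (Cexp (Ci * w) - Cexp (- (Ci * w)))%C); [|apply cderiv_const].
    apply cderiv_ext with
      (f := fun w => (Cexp (Ci * w + 0) + - RtoC 1 * Cexp (- Ci * w + 0))%C).
    { intros w. replace (- Ci * w + 0)%C with (- (Ci * w))%C by ring.
      replace (Ci * w + 0)%C with (Ci * w)%C by ring. ring. }
    apply cderiv_plus; [|apply cderiv_mult; [apply cderiv_const|]];
      (apply (cderiv_comp Cexp); [apply cderiv_Cexp|apply cderiv_affine]).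
  - cbv beta. replace (- Ci * z + 0)%C with (- (Ci * z))%C by ring.
    replace (Ci * z + 0)%C with (Ci * z)%C by ring.
    field; auto.
Qed.

(** With a = exp (i z) and b = exp (-i z) one has cot z + i = 2 i a / (a - b), where |a| <= 1/100
    and |a - b| >= 99. *)
Lemma Csin_cot_bound (z : C) :
  100 <= Im z -> Csin z <> RtoC 0 /\ Cmod (Ccos z / Csin z + Ci) <= / 100.
Proof.
  intros Hz. pose proof (RtoC_neq_0 2 ltac:(lra)) as H2. pose proof Ci_nz as HC.
  unfold Ccos, Csin. set (a := Cexp (Ci * z)). set (b := Cexp (- (Ci * z))).
  assert (Ha : Cmod a <= / 100).
  { unfold a; rewrite Cmod_Cexp.
    replace (Re (Ci * z)) with (- Im z) by (unfold Re, Im; simpl; ring).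
    rewrite exp_Ropp. apply Rinv_le_contravar; [lra|].
    pose proof (exp_ineq1_le (Im z)); lra. }
  assert (Hb : 100 <= Cmod b).
  { unfold b; rewrite Cmod_Cexp.
    replace (Re (- (Ci * z))) with (Im z) by (unfold Re, Im; simpl; ring).
    pose proof (exp_ineq1_le (Im z)); lra. }
  assert (Hab : 99 <= Cmod (a - b)).
  { rewrite Cmod_minus_sym. pose proof (Cmod_rev_triangle b a); lra. }
  assert (Hn : (a - b)%C <> RtoC 0) by (apply Cmod_gt_0; lra).
  split.
  - apply Cmult_neq_0; auto. intros E.
    apply (Cmult_neq_0 (2 * Ci) (/ (2 * Ci))%C); auto using Cmult_neq_0, C1_nz.
    + intros E'. rewrite E' in E. apply C1_nz.
      rewrite <- (Cinv_r (2 * Ci)) by auto using Cmult_neq_0. rewrite E'; ring.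
    + rewrite E; ring.
  - replace ((a + b) / 2 / ((a - b) / (2 * Ci)) + Ci)%C
      with (RtoC 2 * Ci * a / (a - b))%C by (field; auto).
    rewrite Cmod_div, !Cmod_mult, Cmod_Ci, Cmod_R by auto.
    rewrite Rabs_pos_eq by lra.
    apply Rmult_le_reg_r with (Cmod (a - b)); [lra|].
    unfold Rdiv; rewrite Rmult_assoc, Rinv_l by lra. lra.
Qed.

(** * Bounds for the real and imaginary parts of the digamma sums *)

Fixpoint shift_sum (h : R -> R) (x : R) (m : nat) : R :=
  match m with
  | O => 0
  | S k => shift_sum h x k + h (x + INR k)
  end.

Lemma inv_sum_re_im (z : C) (m : nat) :
  Re (inv_sum z m) =
    shift_sum (fun u => u / (u ^ 2 + Im z ^ 2)) (Re z) m /\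
  Im (inv_sum z m) =
    shift_sum (fun u => - Im z / (u ^ 2 + Im z ^ 2)) (Re z) m.
Proof.
  induction m as [|m [IH1 IH2]]; [split; reflexivity|].
  cbn [inv_sum shift_sum]. rewrite <- IH1, <- IH2.
  unfold Re, Im; simpl. rewrite !Rplus_0_r. split; reflexivity.
Qed.

Lemma shift_sum_head (h : R -> R) (x : R) (m : nat) :
  shift_sum h x (S m) = h x + shift_sum h (x + 1) m.
Proof.
  induction m as [|m IH]; [simpl; rewrite Rplus_0_r; ring|].
  change (shift_sum h x (S (S m))) with (shift_sum h x (S m) + h (x + INR (S m))).
  rewrite IH. cbn [shift_sum]. rewrite S_INR.
  replace (x + (INR m + 1)) with (x + 1 + INR m) by ring. ring.
Qed.

Lemma shift_sum_le_telescope (h F : R -> R) (x : R) (m : nat) :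
  (forall k, (k < m)%nat -> h (x + INR k) <= F (x + INR k + 1) - F (x + INR k)) ->
  shift_sum h x m <= F (x + INR m) - F x.
Proof.
  induction m as [|m IH]; intros H; [simpl; rewrite Rplus_0_r; lra|].
  cbn [shift_sum]. specialize (IH (fun k Hk => H k (Nat.lt_lt_succ_r _ _ Hk))).
  specialize (H m (Nat.lt_succ_diag_r m)).
  rewrite S_INR, <- Rplus_assoc; lra.
Qed.

Lemma shift_sum_opp (h : R -> R) (x : R) (m : nat) :
  shift_sum (fun u => - h u) x m = - shift_sum h x m.
Proof. induction m as [|m IH]; simpl; [|rewrite IH]; ring. Qed.

(** Since u^2 + t^2 >= 2 u t, each term is at most 1/200, and the first 41 add up to at most 41/200
    <= 1/4. A later term with index k is at most 1 / k <= ln k - ln (k - 1), and these telescope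
    from 40. *)
Lemma shift_sum_re_upper (t x : R) (n : nat) :
  100 <= t -> 0 <= x -> (40 <= n)%nat ->
  shift_sum (fun u => u / (u ^ 2 + t ^ 2)) x (S n) <= 1 / 4 + ln (INR n) - ln 40.
Proof.
  intros Ht Hx Hn. set (h := fun u => u / (u ^ 2 + t ^ 2)).
  assert (H0 : forall u, 0 <= u -> h u <= / 200).
  { intros u Hu; unfold h. apply Rmult_le_reg_r with (u ^ 2 + t ^ 2); [nra|].
    unfold Rdiv; rewrite Rmult_assoc, Rinv_l by nra.
    pose proof (pow2_ge_0 (u - 100)). nra. }
  induction Hn as [|n Hn IH].
  - assert (H : forall m, shift_sum h x m <= INR m / 200).
    { induction m as [|m IH]; [simpl; lra|].
      cbn [shift_sum]. specialize (H0 (x + INR m)). pose proof (pos_INR m).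
      rewrite S_INR. lra. }
    specialize (H 41%nat).
    replace (INR 40) with 40 by (simpl; ring). simpl INR in H. lra.
  - change (shift_sum h x (S (S n))) with (shift_sum h x (S n) + h (x + INR (S n))).
    pose proof (ln_step_bound n ltac:(lia)) as Hl.
    assert (P : 0 < INR (S n)) by (apply lt_0_INR; lia).
    assert (h (x + INR (S n)) <= / INR (S n)); [|lra].
    unfold h. apply Rmult_le_reg_r with ((x + INR (S n)) ^ 2 + t ^ 2); [nra|].
    unfold Rdiv; rewrite Rmult_assoc, Rinv_l by nra.
    apply Rmult_le_reg_l with (INR (S n)); auto.
    rewrite <- (Rmult_assoc _ (/ _)), Rinv_r by lra. nra.
Qed.

(* Decreasing the starting point by 1 adds a negative term in front and
   removes a positive one at the end. *)
Lemma shift_sum_re_upper_eventually (t : R) (j : nat) (x : R) :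
  100 <= t -> - INR j <= x -> exists N, forall n, (N <= n)%nat ->
  shift_sum (fun u => u / (u ^ 2 + t ^ 2)) x (S n) - ln (INR n) <= 1 / 4 - ln 40.
Proof.
  intros Ht; revert x; set (h := fun u => u / (u ^ 2 + t ^ 2)).
  assert (Hpos : forall u, 0 < u ^ 2 + t ^ 2) by (intros; nra).
  assert (Q : forall x, 0 <= x -> exists N, forall n, (N <= n)%nat ->
              shift_sum h x (S n) - ln (INR n) <= 1 / 4 - ln 40).
  { intros x Hx; exists 40%nat; intros n Hn.
    pose proof (shift_sum_re_upper t x n Ht Hx Hn) as H. fold h in H. lra. }
  induction j as [|j IH]; intros x Hx.
  - apply Q; simpl in Hx; lra.
  - destruct (Rle_dec 0 x) as [H0|H0]; [apply Q; auto|].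
    destruct (IH (x + 1)) as [N HN]; [rewrite S_INR in Hx; lra|].
    exists (max N (S j)); intros n Hn. specialize (HN n ltac:(lia)).
    rewrite shift_sum_head. cbn [shift_sum] in HN.
    assert (h x <= 0).
    { unfold h. apply Rmult_le_reg_r with (x ^ 2 + t ^ 2); auto.
      unfold Rdiv; rewrite Rmult_assoc, Rinv_l by (specialize (Hpos x); lra). lra. }
    assert (0 <= h (x + 1 + INR n)).
    { unfold h. apply Rmult_le_pos; [|apply Rlt_le, Rinv_0_lt_compat; auto].
      assert (INR (S j) <= INR n) by (apply le_INR; lia). lra. }
    lra.
Qed.

(** Each term is below t / (u (u - 1)), which telescopes to at most t / (x - 1) <= 1. *)
Lemma shift_sum_im_upper (t x : R) (m : nat) :
  0 < t -> 1 + t <= x -> shift_sum (fun u => t / (u ^ 2 + t ^ 2)) x m <= 1.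
Proof.
  intros Ht Hx.
  eapply Rle_trans.
  - apply shift_sum_le_telescope with (F := fun u => - t / (u - 1)).
    intros k _. pose proof (pos_INR k). set (u := x + INR k).
    assert (Hu : 1 + t <= u) by (unfold u; lra).
    replace (- t / (u + 1 - 1) - - t / (u - 1)) with (t / (u * (u - 1)))
      by (field; lra).
    apply Rmult_le_compat_l; [lra|]. apply Rinv_le_contravar; nra.
  - pose proof (pos_INR m).
    assert (0 < / (x + INR m - 1)) by (apply Rinv_0_lt_compat; lra).
    assert (t / (x - 1) <= 1).
    { apply Rmult_le_reg_r with (x - 1); [lra|].
      unfold Rdiv; rewrite Rmult_assoc, Rinv_l by lra. lra. }
    unfold Rdiv in *. nra.
Qed.

Lemma atan_le_id (y : R) : 0 < y -> atan y <= y.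
Proof.
  intros Hy.
  destruct (MVT_cor2 atan (fun x => / (1 + x ^ 2)) 0 y Hy) as [c [Hc _]].
  { intros c _; apply derivable_pt_lim_atan. }
  rewrite atan_0 in Hc.
  assert (/ (1 + c ^ 2) <= / 1) by (apply Rinv_le_contravar; nra).
  rewrite Rinv_1 in *. nra.
Qed.

(** The mean value theorem evaluates the derivative at some c in (u, u + 1). As u^2 <= c^2 + 2 |c| +
    1 and 200 |c| <= c^2 + 100^2, moving from c to u costs less than the factor 1.03 once t >=
    100. *)
Lemma atan_step (t u : R) :
  100 <= t ->
  atan ((u + 1) / t) - atan (u / t) <= 1.03 * (t / (u ^ 2 + t ^ 2)).
Proof.
  intros Ht.
  destruct (MVT_cor2 (fun v => atan (v / t)) (fun v => t / (v ^ 2 + t ^ 2)) u (u + 1))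
    as [c [Hc1 Hc2]]; [lra| |].
  - intros c _. apply is_derive_Reals. auto_derive; auto. field. nra.
  - cbv beta in Hc1. rewrite Hc1. replace (u + 1 - u) with 1 by ring.
    rewrite Rmult_1_r. apply Rmult_le_reg_r with (c ^ 2 + t ^ 2); [nra|].
    unfold Rdiv. rewrite Rmult_assoc, Rinv_l, Rmult_1_r by nra.
    apply Rmult_le_reg_r with (u ^ 2 + t ^ 2); [nra|].
    replace (1.03 * (t * / (u ^ 2 + t ^ 2)) * (c ^ 2 + t ^ 2) * (u ^ 2 + t ^ 2))
      with (t * (1.03 * (c ^ 2 + t ^ 2))) by (field; nra).
    apply Rmult_le_compat_l; [lra|].
    assert (u ^ 2 <= c ^ 2 + 2 * Rabs c + 1).
    { pose proof (Rle_abs c); pose proof (Rle_abs (- c)) as Hc; rewrite Rabs_Ropp in Hc.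
      destruct (Rle_dec 0 u); nra. }
    assert (200 * Rabs c <= c ^ 2 + 100 ^ 2).
    { rewrite <- (pow2_abs c). pose proof (pow2_ge_0 (Rabs c - 100)). nra. }
    nra.
Qed.

(** The arctangent rises from at most -PI/4 at x / t to at least PI/2 - 1/10 once x + m >= 10 t, and
    (3 PI / 4 - 1/10) / 1.03 exceeds PI/2 + 1/40. The surplus 1/40 will absorb the cotangent error
    PI/200. *)
Lemma shift_sum_im_lower (t x : R) :
  100 <= t -> x <= - t -> exists N, forall m, (N <= m)%nat ->
  PI / 2 + / 40 < shift_sum (fun u => t / (u ^ 2 + t ^ 2)) x m.
Proof.
  intros Ht Hx. destruct (INR_unbounded (10 * t - x)) as [N HN].
  exists N; intros m Hm. assert (INR N <= INR m) by (apply le_INR; auto).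
  pose proof (shift_sum_le_telescope
    (fun u => - (t / (u ^ 2 + t ^ 2))) (fun u => - atan (u / t) / 1.03) x m) as H1.
  rewrite shift_sum_opp in H1. cbv beta in H1.
  assert (A : - shift_sum (fun u => t / (u ^ 2 + t ^ 2)) x m <=
              - atan ((x + INR m) / t) / 1.03 - - atan (x / t) / 1.03).
  { apply H1. intros k _. pose proof (atan_step t (x + INR k) Ht).
    unfold Rdiv in *. lra. }
  assert (B : atan (x / t) <= - (PI / 4)).
  { rewrite <- atan_1, <- atan_opp.
    assert (E : x / t <= -1).
    { apply Rmult_le_reg_r with t; [lra|].
      unfold Rdiv; rewrite Rmult_assoc, Rinv_l by lra. lra. }
    destruct E as [E|E]; [apply Rlt_le, atan_increasing; lra|rewrite E].
    apply Req_le; f_equal; ring. }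
  assert (D : PI / 2 - / 10 <= atan ((x + INR m) / t)).
  { set (y := (x + INR m) / t).
    assert (Hy : 10 <= y).
    { apply Rmult_le_reg_r with t; [lra|].
      unfold y, Rdiv; rewrite Rmult_assoc, Rinv_l by lra. lra. }
    pose proof (atan_inv y ltac:(lra)).
    pose proof (atan_le_id (/ y) ltac:(apply Rinv_0_lt_compat; lra)).
    assert (/ y <= / 10) by (apply Rinv_le_contravar; lra). lra. }
  pose proof PI2_3_2. lra.
Qed.

(** Here [psi] stands for the value of the digamma function at 1 - s; it is a parameter because
    [cderiv_CGamma] supplies it only as a limit. *)
Definition dlog_chi (s psi : C) : C :=
  (RtoC (ln 2) + RtoC (ln PI) +
   RtoC (PI / 2) * (Ccos (RtoC PI * s / 2) / Csin (RtoC PI * s / 2)) - psi)%C.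

Lemma Im_half_PI_mult (s : C) :
  100 <= Im s -> 100 <= Im (RtoC PI * s / 2)%C.
Proof.
  intros Hs.
  replace (Im (RtoC PI * s / 2)) with (PI / 2 * Im s)
    by (unfold Im; simpl; field).
  pose proof PI2_1. nra.
Qed.

Lemma cderiv_chi (s : C) :
  100 <= Im s -> exists psi,
    clim (fun n => digamma_term (1 - s) n) psi /\
    cderiv chi s (chi s * dlog_chi s psi)%C.
Proof.
  intros Hs.
  destruct (cderiv_CGamma (1 - s)) as [psi [Hpsi HG]].
  { unfold Im in *; simpl; lra. }
  destruct (Csin_cot_bound _ (Im_half_PI_mult s Hs)) as [Hsin _].
  pose proof (RtoC_neq_0 2 ltac:(lra)) as H2.
  exists psi; split; auto. unfold chi, Rcpow.
  eapply cderiv_eq.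
  - apply cderiv_mult with (g := fun w => CGamma (1 - w)).
    + apply cderiv_mult with (g := fun w => Csin (RtoC PI * w / 2)).
      * apply cderiv_mult with (f := fun w => Cexp (w * RtoC (ln 2)))
          (g := fun w => Cexp ((w - 1) * RtoC (ln PI))).
        -- apply cderiv_ext with (f := fun w => Cexp (RtoC (ln 2) * w + 0)).
           { intros w; f_equal; ring. }
           apply (cderiv_comp Cexp); [apply cderiv_Cexp|apply cderiv_affine].
        -- apply cderiv_ext with
             (f := fun w => Cexp (RtoC (ln PI) * w + - RtoC (ln PI))).
           { intros w; f_equal; ring. }
           apply (cderiv_comp Cexp); [apply cderiv_Cexp|apply cderiv_affine].
      * apply cderiv_ext with (f := fun w => Csin (RtoC PI / 2 * w + 0)).
        { intros w; f_equal; field; auto. }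
        apply (cderiv_comp Csin); [|apply cderiv_affine].
        replace (RtoC PI / 2 * s + 0)%C with (RtoC PI * s / 2)%C by (field; auto).
        apply cderiv_Csin.
    + apply cderiv_ext with (f := fun w => CGamma (- RtoC 1 * w + 1)).
      { intros w; f_equal; ring. }
      apply (cderiv_comp CGamma); [|apply cderiv_affine].
      replace (- RtoC 1 * s + 1)%C with (1 - s)%C by ring. exact HG.
  - cbv beta. unfold dlog_chi.
    replace (RtoC (ln 2) * s + 0)%C with (s * RtoC (ln 2))%C by ring.
    replace (RtoC (ln PI) * s + - RtoC (ln PI))%C with ((s - 1) * RtoC (ln PI))%C by ring.
    rewrite RtoC_div by lra.
    field; auto.
Qed.

(** Up to an error of PI/200, the imaginary part of l is -PI/2 - Im psi. On the left Im psi >= -1,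
    which PI/2 > 3/2 outweighs; on the right Im psi <= -PI/2 - 1/40, which beats the error because
    PI <= 4. The limits on Re s are those on x = 1 - Re s in the two bounds for the sums. *)
Lemma cderiv_chi_sign (s : C) :
  100 <= Im s -> exists l,
    cderiv chi s (chi s * l)%C /\ Re l < 0 /\
    (Re s <= - Im s -> Im l < 0) /\ (Im s + 1 <= Re s -> 0 < Im l).
Proof.
  intros Hs. destruct (cderiv_chi s Hs) as [psi [Hpsi Hd]].
  exists (dlog_chi s psi); split; auto.
  destruct (Csin_cot_bound _ (Im_half_PI_mult s Hs)) as [_ Hcot].
  unfold dlog_chi.
  set (c := (Ccos (RtoC PI * s / 2) / Csin (RtoC PI * s / 2))%C) in *.
  pose proof PI2_3_2 as Hpi. pose proof PI_4 as Hpi4.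
  pose proof (re_le_Cmod (c + Ci)) as Rc. pose proof (im_le_Cmod (c + Ci)) as Ic.
  replace (Re (c + Ci)) with (Re c) in Rc by (unfold Re; simpl; ring).
  replace (Im (c + Ci)) with (Im c + 1) in Ic by reflexivity.
  assert (Rc' := proj1 (Rabs_le_between _ _) (Rle_trans _ _ _ Rc Hcot)).
  assert (Ic' := proj1 (Rabs_le_between _ _) (Rle_trans _ _ _ Ic Hcot)).
  set (x := 1 - Re s).
  assert (E : forall n, Re (digamma_term (1 - s) n) =
      ln (INR n) - shift_sum (fun u => u / (u ^ 2 + Im s ^ 2)) x (S n) /\
      Im (digamma_term (1 - s) n) =
      - shift_sum (fun u => Im s / (u ^ 2 + Im s ^ 2)) x (S n)).
  { intros n. destruct (inv_sum_re_im (1 - s) (S n)) as [E1 E2].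
    replace (Re (1 - s)) with x in * by reflexivity.
    replace (Im (1 - s)) with (- Im s) in * by (unfold Im; simpl; ring).
    replace ((- Im s) ^ 2) with (Im s ^ 2) in * by ring.
    rewrite Ropp_involutive in E2.
    rewrite <- E1, <- E2. unfold digamma_term, Re, Im; simpl; split; ring. }
  split; [|split].
  - assert (Hre : ln 40 - 1 / 4 <= Re psi).
    { destruct (INR_unbounded (- x)) as [j Hj].
      destruct (shift_sum_re_upper_eventually (Im s) j x Hs ltac:(lra)) as [N HN].
      apply (is_lim_seq_le_loc (fun _ => ln 40 - 1 / 4)
               (fun n => Re (digamma_term (1 - s) n)) (ln 40 - 1 / 4) (Re psi)).
      - exists N; intros n Hn. destruct (E n) as [-> _]. specialize (HN n Hn). lra.
      - apply is_lim_seq_const.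
      - apply clim_re; auto. }
    (* Indeed 2 PI e <= 2 * 4 * 3 = 24. The gap of 1 covers the 1/4 lost in [Hre] and the cotangent
       error. *)
    assert (Hln : ln 2 + ln PI + 1 <= ln 40).
    { rewrite <- (ln_exp 1), <- ln_mult, <- ln_mult by (try apply exp_pos; lra).
      pose proof exp_le_3. pose proof (exp_pos 1).
      assert (PI * exp 1 <= 4 * 3) by (apply Rmult_le_compat; lra).
      apply ln_le; [|lra]. apply Rmult_lt_0_compat; lra. }
    replace (Re _) with (ln 2 + ln PI + PI / 2 * Re c - Re psi)
      by (unfold Re; simpl; ring).
    nra.
  - intros Hl.
    assert (Him : -1 <= Im psi).
    { apply (is_lim_seq_le (fun _ => -1)
               (fun n => Im (digamma_term (1 - s) n)) (-1) (Im psi)).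
      - intros n; destruct (E n) as [_ ->].
        pose proof (shift_sum_im_upper (Im s) x (S n) ltac:(lra) ltac:(unfold x; lra)). lra.
      - apply is_lim_seq_const.
      - apply clim_im; auto. }
    replace (Im _) with (PI / 2 * Im c - Im psi) by (unfold Im; simpl; ring).
    nra.
  - intros Hl.
    assert (Him : Im psi <= - (PI / 2 + / 40)).
    { destruct (shift_sum_im_lower (Im s) x Hs ltac:(unfold x; lra)) as [N HN].
      apply (is_lim_seq_le_loc (fun n => Im (digamma_term (1 - s) n))
               (fun _ => - (PI / 2 + / 40)) (Im psi) (- (PI / 2 + / 40))).
      - exists N; intros n Hn. destruct (E n) as [_ ->].
        specialize (HN (S n) ltac:(lia)). lra.
      - apply clim_im; auto.
      - apply is_lim_seq_const. }
    replace (Im _) with (PI / 2 * Im c - Im psi) by (unfold Im; simpl; ring).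
    nra.
Qed.

(** * The argument of chi and the inverse map *)

Lemma continuous_C_R (A : C -> R) (s : C) :
  continuous A s -> forall eps, 0 < eps -> exists d, 0 < d /\
    forall w, Cmod (w - s) < d -> Rabs (A w - A s) < eps.
Proof.
  intros H eps He.
  apply (proj1 (filterlim_locally _ _)) with (eps := mkposreal _ He) in H.
  destruct H as [d Hd]. exists d; split; [apply cond_pos|]; intros w Hw.
  apply (Hd w). apply C_NormedModule_mixin_compat1. exact Hw.
Qed.

Lemma cderiv_is_derive (f : C -> C) (z l : C) :
  cderiv f z l -> @is_derive C_AbsRing C_NormedModule f z l.
Proof.
  intros H; split.
  - apply is_linear_scal_l.
  - intros x Hx.
    apply (is_filter_lim_locally_unique (V := AbsRing_NormedModule C_AbsRing)) in Hx.
    subst x.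
    intros eps. destruct (cderiv_error _ _ _ H eps (cond_pos eps)) as [d [Hd Hdd]].
    exists (mkposreal _ Hd); intros w Hw.
    specialize (Hdd w Hw).
    change (Cmod (f w - f z - (w - z) * l) <= eps * Cmod (w - z)).
    rewrite (Cmult_comm _ l); exact Hdd.
Qed.

Lemma cderiv_horizontal (f : C -> C) (x y : R) (l : C) :
  cderiv f (x, y) l ->
  is_derive (fun u : R => Re (f (u, y))) x (Re l) /\
  is_derive (fun u : R => Im (f (u, y))) x (Im l).
Proof.
  intros H.
  (* Real and imaginary parts are treated together, as real-linear functionals bounded by the
     modulus. *)
  assert (G : forall p : C -> R,
    (forall a b, p (a - b)%C = p a - p b) -> (forall r a, p (RtoC r * a)%C = r * p a) ->
    (forall a, Rabs (p a) <= Cmod a) ->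
    is_derive (fun u : R => p (f (u, y))) x (p l)).
  { intros p Pm Ps Pb. apply is_derive_Reals; intros eps He.
    destruct (cderiv_error _ _ _ H (eps / 2) ltac:(lra)) as [d [Hd Hdd]].
    exists (mkposreal _ Hd); intros h Hh0 Hh; simpl in Hh.
    change (Rabs ((p (f ((x + h)%R, y)) - p (f (x, y))) / h - p l) < eps).
    assert (E : (((x + h)%R, y) - (x, y) = RtoC h)%C).
    { unfold Cminus, Cplus, Copp, RtoC; simpl; f_equal; ring. }
    specialize (Hdd ((x + h)%R, y)). rewrite E, Cmod_R in Hdd. specialize (Hdd Hh).
    assert (Ph : 0 < Rabs h) by (apply Rabs_pos_lt; auto).
    replace ((p (f ((x + h)%R, y)) - p (f (x, y))) / h - p l)
      with (p (f ((x + h)%R, y) - f (x, y) - l * RtoC h)%C / h).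
    - unfold Rdiv; rewrite Rabs_mult, Rabs_inv.
      apply Rle_lt_trans with (eps / 2); [|lra].
      apply Rmult_le_reg_r with (Rabs h); auto.
      rewrite Rmult_assoc, Rinv_l, Rmult_1_r by lra.
      eapply Rle_trans; [apply Pb|exact Hdd].
    - rewrite Cmult_comm, !Pm, Ps. field; auto. }
  split; apply G; intros; try reflexivity;
    auto using re_le_Cmod, im_le_Cmod; unfold Re, Im; simpl; ring.
Qed.

(** Near s the quotient q = chi / chi s is close to 1 and, by continuity, A moves by less than PI/2.
    The change of A is therefore the principal value atan (Im q / Re q), whose derivative where q =
    1 is the imaginary part of q' = l. *)
Lemma arg_chi_derive (A : C -> R) (x t : R) (l : C) :
  is_arg_chi A -> 0 < t -> chi (x, t) <> RtoC 0 ->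
  cderiv chi (x, t) (chi (x, t) * l)%C ->
  is_derive (fun u : R => A (u, t)) x (Im l).
Proof.
  intros [Hc [Hp _]] Ht Hn Hd. set (s := (x, t) : C) in *.
  set (q := fun w : C => (chi w * / chi s)%C).
  assert (Hq : cderiv q s l).
  { eapply cderiv_eq; [apply cderiv_mult; [exact Hd|apply cderiv_const]|].
    cbv beta; field; auto. }
  assert (Eq : q s = RtoC 1) by (apply Cinv_r; auto).
  destruct (cderiv_horizontal q x t l Hq) as [HR HI].
  pose proof (cderiv_cont _ _ _ Hq (1 / 2) ltac:(lra)) as [d1 [Hd1 H1]].
  pose proof PI2_1 as Hpi.
  destruct (continuous_C_R A s (Hc s Ht) (PI / 2) ltac:(lra)) as [d2 [Hd2 H2]].
  apply is_derive_ext_loc with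
    (f := fun u => A s + atan (Im (q (u, t)) / Re (q (u, t)))).
  - exists (mkposreal (Rmin d1 d2) (Rmin_glb_lt _ _ _ Hd1 Hd2)).
    intros u Hu. change (Rabs (u - x) < Rmin d1 d2) in Hu.
    set (w := (u, t) : C).
    assert (Hw : Cmod (w - s) < Rmin d1 d2).
    { replace (w - s)%C with (RtoC (u - x)); [rewrite Cmod_R; auto|].
      unfold w, s, Cminus, Cplus, Copp, RtoC; simpl; f_equal; ring. }
    specialize (H1 w (Rlt_le_trans _ _ _ Hw (Rmin_l _ _))).
    specialize (H2 w (Rlt_le_trans _ _ _ Hw (Rmin_r _ _))).
    rewrite Eq in H1.
    set (a := A w - A s) in *. apply Rabs_lt_between in H2.
    set (rho := Cmod (chi w) / Cmod (chi s)).
    assert (Ps : 0 < Cmod (chi s)) by (apply Cmod_gt_0; auto).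
    assert (E : q w = (RtoC rho * (cos a, sin a))%C).
    { unfold q, rho. rewrite (Hp w), (Hp s) at 1 by exact Ht.
      rewrite RtoC_div by lra.
      assert (Ee : (Cexp (Ci * RtoC (A w)) = (cos a, sin a) * Cexp (Ci * RtoC (A s)))%C).
      { replace (Ci * RtoC (A w))%C with (Ci * RtoC a + Ci * RtoC (A s))%C
          by (unfold a; rewrite RtoC_minus; ring).
        rewrite Cexp_plus. f_equal. unfold Cexp, Re, Im; simpl.
        replace (0 * a - 1 * 0) with 0 by ring.
        replace (0 * 0 + 1 * a) with a by ring. rewrite exp_0; f_equal; ring. }
      rewrite Ee. field. split; [apply RtoC_neq_0; lra|apply Cexp_neq_0]. }
    assert (Ca : 0 < cos a) by (apply cos_gt_0; lra).
    assert (Hre : Re (q w) = rho * cos a) by (rewrite E; unfold Re; simpl; ring).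
    assert (Him : Im (q w) = rho * sin a) by (rewrite E; unfold Im; simpl; ring).
    assert (Hrho : rho <> 0).
    { intros Z. pose proof (re_le_Cmod (q w - 1)) as B.
      replace (Re (q w - 1)) with (Re (q w) - 1) in B by reflexivity.
      rewrite Hre, Z, Rmult_0_l, Rminus_0_l, Rabs_Ropp, Rabs_R1 in B. lra. }
    change (A s + atan (Im (q w) / Re (q w)) = A w).
    rewrite Hre, Him.
    replace (rho * sin a / (rho * cos a)) with (tan a)
      by (unfold tan; field; split; auto; lra).
    rewrite atan_tan by lra. unfold a; ring.
  - set (P := fun u : R => Re (q (u, t))). set (Q := fun u : R => Im (q (u, t))).
    assert (P1 : P x = 1) by (unfold P; fold s; rewrite Eq; reflexivity).
    assert (Q0 : Q x = 0) by (unfold Q; fold s; rewrite Eq; reflexivity).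
    change (is_derive P x (Re l)) in HR. change (is_derive Q x (Im l)) in HI.
    change (is_derive (fun u : R => A s + atan (Q u / P u)) x (Im l)).
    auto_derive.
    + repeat split; [exists (Im l); auto|exists (Re l); auto|rewrite P1; lra].
    + replace (Derive (fun u => Q u) x) with (Im l)
        by (symmetry; apply is_derive_unique, HI).
      replace (Derive (fun u => P u) x) with (Re l)
        by (symmetry; apply is_derive_unique, HR).
      rewrite P1, Q0. field.
Qed.

(** The argument decreases up to sigma = -t and increases from sigma = t + 1 on, so its minimum over
    the compact interval between them is global. *)
Lemma arg_chi_bounded_below (A : C -> R) (t : R) :
  is_arg_chi A -> 100 <= t -> (forall x, chi (x, t) <> RtoC 0) ->
  exists c, forall x, c <= A (x, t).
Proof.
  intros HA Ht Hn.
  assert (Hder : forall x, exists d, is_derive (fun u : R => A (u, t)) x d /\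
            (x <= - t -> d < 0) /\ (t + 1 <= x -> 0 < d)).
  { intros x. destruct (cderiv_chi_sign (x, t) Ht) as [l [Hl [_ [H1 H2]]]].
    exists (Im l); split; auto. apply arg_chi_derive; auto; lra. }
  set (D := Derive (fun u => A (u, t))).
  assert (HD : forall x, derivable_pt_lim (fun u => A (u, t)) x (D x)).
  { intros x. destruct (Hder x) as [d [Hd _]]. apply is_derive_Reals.
    unfold D; rewrite (is_derive_unique _ _ _ Hd); auto. }
  assert (HDl : forall x, x <= - t -> D x < 0).
  { intros x Hx; destruct (Hder x) as [d [Hd [H1 _]]].
    unfold D; rewrite (is_derive_unique _ _ _ Hd); auto. }
  assert (HDr : forall x, t + 1 <= x -> 0 < D x).
  { intros x Hx; destruct (Hder x) as [d [Hd [_ H1]]].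
    unfold D; rewrite (is_derive_unique _ _ _ Hd); auto. }
  destruct (continuity_ab_min (fun u => A (u, t)) (- t) (t + 1)) as [x0 [Hx0 _]]; [lra| |].
  { intros c _. apply derivable_continuous_pt. exists (D c); apply HD. }
  exists (A (x0, t)); intros x.
  destruct (Rlt_dec x (- t)) as [L|L]; [|destruct (Rlt_dec (t + 1) x) as [G|G]].
  - destruct (MVT_cor2 (fun u => A (u, t)) D x (- t) L) as [c [Hc1 Hc2]];
      [intros; apply HD|].
    specialize (Hx0 (- t) ltac:(lra)). specialize (HDl c ltac:(lra)). nra.
  - destruct (MVT_cor2 (fun u => A (u, t)) D (t + 1) x G) as [c [Hc1 Hc2]];
      [intros; apply HD|].
    specialize (Hx0 (t + 1) ltac:(lra)). specialize (HDr c ltac:(lra)). nra.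
  - apply Hx0; lra.
Qed.

(** * Minimal modulus, open maps and differentiable inverses *)

Lemma Cmod_min_on_rectangle (f : C -> C) (a b a' b' : R) :
  a <= b -> a' <= b' ->
  (forall x y, a <= x <= b -> a' <= y <= b' -> cont_at f (x, y)) ->
  exists x0 y0, a <= x0 <= b /\ a' <= y0 <= b' /\
    forall x y, a <= x <= b -> a' <= y <= b' -> Cmod (f (x0, y0)) <= Cmod (f (x, y)).
Proof.
  intros Hab Hab' Hc. apply NNPP; intros Hmin.
  (* Moduli are negated because [completeness] yields suprema. If the infimum -M is not attained,
     every point has a neighbourhood where the modulus exceeds -M by a margin; compactness makes the
     margin uniform, contradicting the infimum. *)
  set (E := fun v => exists x y, a <= x <= b /\ a' <= y <= b' /\ v = - Cmod (f (x, y))).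
  destruct (completeness E) as [M [HM1 HM2]].
  { exists 0; intros v [x [y [_ [_ ->]]]]. pose proof (Cmod_ge_0 (f (x, y))); lra. }
  { exists (- Cmod (f (a, a'))), a, a'; repeat split; lra. }
  assert (Hgt : forall x y, a <= x <= b -> a' <= y <= b' -> - M < Cmod (f (x, y))).
  { intros x y Hx Hy. apply Rnot_le_lt; intros Hle. apply Hmin.
    exists x, y; repeat split; try lra. intros x' y' Hx' Hy'.
    assert (- Cmod (f (x', y')) <= M) by (apply HM1; exists x', y'; auto). lra. }
  assert (Hdelta : forall p : R * R, exists d : posreal,
    a <= fst p <= b -> a' <= snd p <= b' ->
    forall x y, Rabs (x - fst p) < d -> Rabs (y - snd p) < d -> - M + d < Cmod (f (x, y))).
  { intros [u v]; simpl.
    destruct (classic (a <= u <= b /\ a' <= v <= b')) as [[Hu Hv]|N].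
    - specialize (Hgt u v Hu Hv). set (e := (Cmod (f (u, v)) + M) / 2).
      assert (He : 0 < e) by (unfold e; lra).
      destruct (Hc u v Hu Hv e He) as [d [Hd Hdd]].
      assert (Hd' : 0 < Rmin (d / 2) e) by (apply Rmin_glb_lt; lra).
      exists (mkposreal _ Hd'); intros _ _ x y Hx Hy; simpl in *.
      pose proof (Rmin_l (d / 2) e); pose proof (Rmin_r (d / 2) e).
      assert (Cmod ((x, y) - (u, v)) < d).
      { eapply Rle_lt_trans; [apply Cmod_le_re_im|]. unfold Re, Im; simpl.
        unfold Rminus in *; lra. }
      specialize (Hdd (x, y) H1). rewrite Cmod_minus_sym in Hdd.
      pose proof (Cmod_rev_triangle (f (u, v)) (f (x, y))). unfold e in *; lra.
    - exists (mkposreal 1 Rlt_0_1); intros Hu Hv; exfalso; apply N; auto. }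
  set (delta := fun u v => proj1_sig (constructive_indefinite_description _ (Hdelta (u, v)))).
  assert (Hdl : forall u v, a <= u <= b -> a' <= v <= b' -> forall x y,
    Rabs (x - u) < delta u v -> Rabs (y - v) < delta u v -> - M + delta u v < Cmod (f (x, y))).
  { intros u v Hu Hv x y. unfold delta.
    destruct (constructive_indefinite_description _ (Hdelta (u, v))) as [d Hd]; simpl.
    apply Hd; auto. }
  destruct (compactness_value_2d a b a' b' delta) as [d Hd].
  assert (M <= M - d); [|pose proof (cond_pos d); lra].
  apply HM2. intros v [x [y [Hx [Hy ->]]]].
  (* [compactness_value_2d] gives its covering point only under a double negation, so the goal is
     first turned into a refutation. *)
  apply Rnot_lt_le; intros Hlt. apply (Hd x y Hx Hy).
  intros [u [w [Hu [Hw [H1 [H2 H3]]]]]].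
  specialize (Hdl u w Hu Hw x y H1 H2). lra.
Qed.

(* A value close to [f s0] is taken where its distance to [f] is minimal on a
   small square: at an interior point with nonzero derivative, a nonzero
   distance could be decreased. *)
Lemma cderiv_open_map (f : C -> C) (s0 : C) (r0 r : R) :
  0 < r0 -> 0 < r ->
  (forall w, Cmod (w - s0) < r0 -> exists l, l <> RtoC 0 /\ cderiv f w l) ->
  exists rho, 0 < rho /\
    forall z, Cmod (z - f s0) < rho -> exists s, Cmod (s - s0) < r /\ f s = z.
Proof.
  intros Hr0 Hr Hd.
  assert (E0 : Cmod (s0 - s0) = 0).
  { replace (s0 - s0)%C with (RtoC 0) by ring; apply Cmod_0. }
  destruct (Hd s0 ltac:(lra)) as [l0 [Hl0 Hd0]].
  assert (Pl : 0 < Cmod l0) by (apply Cmod_gt_0; auto).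
  destruct (cderiv_error _ _ _ Hd0 (Cmod l0 / 2) ltac:(lra)) as [d [Hdp Hdd]].
  (* Points of the square with half-side [e] lie within 2 e of the centre, hence strictly inside all
     three balls. *)
  set (e := Rmin (Rmin r0 r) d / 4).
  assert (He : 0 < e).
  { unfold e. assert (0 < Rmin (Rmin r0 r) d) by (repeat apply Rmin_glb_lt; auto). lra. }
  assert (He1 : 4 * e <= r0 /\ 4 * e <= r /\ 4 * e <= d).
  { unfold e. pose proof (Rmin_l (Rmin r0 r) d); pose proof (Rmin_r (Rmin r0 r) d).
    pose proof (Rmin_l r0 r); pose proof (Rmin_r r0 r). lra. }
  (* At distance at least e from s0, f moves by at least |l0| e / 2, so |f - z| exceeds |l0| e / 4
     there, while at s0 it is smaller. The minimum thus lies in the open disc of radius e. *)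
  exists (Cmod l0 * e / 4).
  assert (Prho : 0 < Cmod l0 * e) by (apply Rmult_lt_0_compat; auto).
  split; [lra|]; intros z Hz.
  set (g := fun w => (f w + - z)%C).
  destruct s0 as [x0 y0].
  assert (Hin : forall x y, x0 - e <= x <= x0 + e -> y0 - e <= y <= y0 + e ->
            Cmod ((x, y) - (x0, y0)) <= 2 * e).
  { intros x y Hx Hy. eapply Rle_trans; [apply Cmod_le_re_im|].
    unfold Re, Im; simpl.
    assert (Rabs (x + - x0) <= e) by (apply Rabs_le; lra).
    assert (Rabs (y + - y0) <= e) by (apply Rabs_le; lra). lra. }
  destruct (Cmod_min_on_rectangle g (x0 - e) (x0 + e) (y0 - e) (y0 + e))
    as [x [y [Hx [Hy Hmin]]]]; [lra|lra| |].
  { intros x y Hx Hy. specialize (Hin x y Hx Hy).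
    destruct (Hd (x, y) ltac:(lra)) as [l [_ Hl]].
    apply cont_at_plus; [apply cderiv_cont with l; auto|apply cont_at_const]. }
  assert (Hg0 : Cmod (g (x, y)) < Cmod l0 * e / 4).
  { eapply Rle_lt_trans; [apply (Hmin x0 y0); lra|].
    unfold g; rewrite Cmod_minus_sym in Hz. exact Hz. }
  assert (Hxy := Hin x y Hx Hy).
  assert (Hint : Cmod ((x, y) - (x0, y0)) < e).
  { apply Rnot_le_lt; intros Hle.
    specialize (Hdd (x, y) ltac:(lra)).
    pose proof (Cmod_rev_triangle (l0 * ((x, y) - (x0, y0)))
                  (- (f (x, y) - f (x0, y0) - l0 * ((x, y) - (x0, y0))))) as T1.
    rewrite Cmod_opp, Cmod_mult in T1.
    replace (l0 * ((x, y) - (x0, y0)) -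
             - (f (x, y) - f (x0, y0) - l0 * ((x, y) - (x0, y0))))%C
      with (g (x, y) + (z - f (x0, y0)))%C in T1 by (unfold g; ring).
    pose proof (Cmod_triangle (g (x, y)) (z - f (x0, y0))). nra. }
  exists (x, y); split; [lra|].
  apply NNPP; intros Hne.
  assert (Hgne : g (x, y) <> RtoC 0).
  { intros E; apply Hne. unfold g in E.
    replace (f (x, y)) with (f (x, y) + - z + z)%C by ring. rewrite E; ring. }
  assert (Pg : 0 < Cmod (g (x, y))) by (apply Cmod_gt_0; auto).
  destruct (Hd (x, y) ltac:(lra)) as [l [Hl Hdl]].
  assert (Pl' : 0 < Cmod l) by (apply Cmod_gt_0; auto).
  destruct (cderiv_error _ _ _ Hdl (Cmod l / 2) ltac:(lra)) as [d' [Hdp' Hdd']].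
  (* The Newton direction: a step -eta v replaces g by (1 - eta) g plus an error of at most (eta /
     2) |g|, so the modulus drops. The bounds on [eta] keep the step within the error estimate and
     the square. *)
  set (v := (g (x, y) / l)%C).
  assert (Pv : 0 < Cmod v) by (unfold v; rewrite Cmod_div; auto; apply Rdiv_lt_0_compat; auto).
  set (eta := Rmin (1 / 2) (Rmin (d' / (2 * Cmod v))
                ((e - Cmod ((x, y) - (x0, y0))) / Cmod v))).
  assert (Heta : 0 < eta).
  { repeat apply Rmin_glb_lt; [lra|apply Rdiv_lt_0_compat; lra|apply Rdiv_lt_0_compat; lra]. }
  assert (Heta1 : eta <= 1 / 2) by apply Rmin_l.
  assert (Heta2 : eta * Cmod v <= d' / 2).
  { replace (d' / 2) with (d' / (2 * Cmod v) * Cmod v) by (field; lra).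
    apply Rmult_le_compat_r; [lra|]. unfold eta.
    eapply Rle_trans; [apply Rmin_r|apply Rmin_l]. }
  assert (Heta3 : eta * Cmod v <= e - Cmod ((x, y) - (x0, y0))).
  { replace (e - Cmod ((x, y) - (x0, y0)))
      with ((e - Cmod ((x, y) - (x0, y0))) / Cmod v * Cmod v) by (field; lra).
    apply Rmult_le_compat_r; [lra|]. unfold eta.
    eapply Rle_trans; [apply Rmin_r|apply Rmin_r]. }
  set (w := ((x, y) - RtoC eta * v)%C).
  assert (Ew : (w - (x, y) = - (RtoC eta * v))%C) by (unfold w; ring).
  assert (Mw : Cmod (w - (x, y)) = eta * Cmod v).
  { rewrite Ew, Cmod_opp, Cmod_mult, Cmod_R, Rabs_pos_eq; lra. }
  specialize (Hdd' w ltac:(lra)). rewrite Mw in Hdd'.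
  assert (Hw : Cmod (w - (x0, y0)) <= e).
  { replace (w - (x0, y0))%C with ((w - (x, y)) + ((x, y) - (x0, y0)))%C by ring.
    eapply Rle_trans; [apply Cmod_triangle|]. lra. }
  assert (Hmw : Cmod (g (x, y)) <= Cmod (g w)).
  { clearbody w. destruct w as [wx wy].
    pose proof (Rle_trans _ _ _ (re_le_Cmod _) Hw) as H1.
    pose proof (Rle_trans _ _ _ (im_le_Cmod _) Hw) as H2.
    unfold Re, Im in H1, H2; simpl in H1, H2.
    apply Rabs_le_between in H1, H2. apply Hmin; lra. }
  assert (Eg : g w = (RtoC (1 - eta) * g (x, y) +
                 (f w - f (x, y) - l * (w - (x, y))))%C).
  { rewrite Ew, RtoC_minus. unfold g, v, g. field; auto. }
  rewrite Eg in Hmw.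
  pose proof (Cmod_triangle (RtoC (1 - eta) * g (x, y)) (f w - f (x, y) - l * (w - (x, y)))) as T.
  rewrite Cmod_mult, Cmod_R, Rabs_pos_eq in T by lra.
  assert (Ev : Cmod l / 2 * (eta * Cmod v) = eta / 2 * Cmod (g (x, y))).
  { unfold v; rewrite Cmod_div by auto. field; lra. }
  nra.
Qed.

(** From z - z0 = q (g z) (g z - g z0) the slope of g is 1 / q (g z); continuity of g makes this
    continuous at z0 and keeps q (g z) away from zero nearby. *)
Lemma cderiv_inverse (f g : C -> C) (z0 l : C) (d : R) :
  0 < d -> (forall z, Cmod (z - z0) < d -> f (g z) = z) ->
  cont_at g z0 -> l <> RtoC 0 -> cderiv f (g z0) l -> cderiv g z0 (/ l)%C.
Proof.
  intros Hd Hfg Hg Hl [q [Hq [Eq [d1 [Hd1 H1]]]]].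
  pose proof (cont_at_comp q g z0 Hg Hq) as Hqg.
  assert (Pl : 0 < Cmod l) by (apply Cmod_gt_0; auto).
  destruct (Hg d1 Hd1) as [d2 [Hd2 H2]].
  destruct (Hqg (Cmod l) Pl) as [d3 [Hd3 H3]].
  exists (fun z => / q (g z))%C; split; [|split].
  - apply (cont_at_inv_fun (fun z => q (g z))); auto. rewrite Eq; auto.
  - rewrite Eq; auto.
  - exists (Rmin d (Rmin d2 d3)); split; [repeat apply Rmin_glb_lt; auto|].
    intros z Hz.
    assert (Hz' := Rlt_le_trans _ _ _ Hz (Rmin_r _ _)).
    specialize (H2 z (Rlt_le_trans _ _ _ Hz' (Rmin_l _ _))).
    specialize (H3 z (Rlt_le_trans _ _ _ Hz' (Rmin_r _ _))).
    specialize (H1 _ H2). rewrite !Hfg in H1.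
    + rewrite H1. field. intros E. rewrite E, Eq in H3.
      replace (0 - l)%C with (- l)%C in H3 by ring. rewrite Cmod_opp in H3; lra.
    + replace (z0 - z0)%C with (RtoC 0) by ring; rewrite Cmod_0; auto.
    + apply Rlt_le_trans with (1 := Hz), Rmin_l.
Qed.

Lemma slit_plane_ball (z : C) :
  slit_plane z -> exists d, 0 < d /\ forall w, Cmod (w - z) < d -> slit_plane w.
Proof.
  intros Hz. destruct (Req_dec (Im z) 0) as [E|N].
  - assert (Re z < 0) by (apply Rnot_le_lt; intros H; apply Hz; auto).
    exists (- Re z); split; [lra|]; intros w Hw [_ H1].
    pose proof (Rle_lt_trans _ _ _ (re_le_Cmod _) Hw) as H2.
    apply Rabs_lt_between in H2. unfold Re in *; simpl in H2; lra.
  - exists (Rabs (Im z)); split; [apply Rabs_pos_lt; auto|]; intros w Hw [H1 _].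
    pose proof (Rle_lt_trans _ _ _ (im_le_Cmod _) Hw) as H2.
    replace (Im (w - z)) with (Im w - Im z) in H2 by reflexivity.
    rewrite H1, Rminus_0_l, Rabs_Ropp in H2; lra.
Qed.

Lemma open_of_Cmod_ball (U : C -> Prop) :
  (forall z, U z -> exists d, 0 < d /\ forall w, Cmod (w - z) < d -> U w) -> open U.
Proof.
  intros H z Hz. destruct (H z Hz) as [d [Hd Hdd]].
  (* Balls of the product topology on [C] are boxes; half the radius puts the box inside the
     disc. *)
  assert (Hd2 : 0 < d / 2) by lra.
  exists (mkposreal _ Hd2); intros w Hw. apply Hdd.
  eapply Rle_lt_trans; [apply Cmod_le_re_im|].
  destruct Hw as [H1 H2].
  change (Rabs (Re (w - z)) < d / 2) in H1. change (Rabs (Im (w - z)) < d / 2) in H2.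
  lra.
Qed.

Theorem lemma3p4 (A : C -> R) (M1 M2 : R)
  (HA : is_arg_chi A)
  (HM1 : 0 < M1) (HM2 : 0 < M2)
  (Hmod : Cmod_chi_decreasing_from M1)
  (Harg : arg_chi_decreasing_from A M2) :
  exists M0 : R, forall M : R, Rmax M1 M2 <= M -> M0 <= M ->
  exists m0 : Z, forall m : Z, (m0 <= m)%Z ->
  forall tau : C -> C,
    inverse_between chi tau (D_m A M1 M2 M m) slit_plane ->
    conformal_onto tau slit_plane (D_m A M1 M2 M m).
Proof.
  exists 0; intros M _ _.
  set (T := Rmax M1 M2). set (T' := Rmax T 100).
  assert (HT1 : M1 <= T) by apply Rmax_l. assert (HT2 : M2 <= T) by apply Rmax_r.
  assert (HT' : T <= T') by apply Rmax_l. assert (H100 : 100 <= T') by apply Rmax_r.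
  (* At a zero the modulus could not decrease further to the right. *)
  assert (Hchi : forall x t, M1 <= t -> chi (x, t) <> RtoC 0).
  { intros x t Ht E. pose proof (Hmod t Ht x (x + 1) ltac:(lra)) as H.
    rewrite E, Cmod_0 in H. pose proof (Cmod_ge_0 (chi ((x + 1)%R, t))); lra. }
  destruct (arg_chi_bounded_below A T' HA H100) as [c Hc].
  { intros x; apply Hchi; lra. }
  pose proof PI2_1 as Hpi.
  (* As 2 PI > 1, every m >= n0 has -2 PI m below both numbers: below [c] to keep [D_m] off the
     lower lines, and below A (1/2, M) so that the argument condition in [D] is automatic. *)
  destruct (INR_unbounded (- Rmin c (A (1 / 2, M)))) as [n0 Hn0].
  exists (Z.of_nat n0); intros m Hm tau [Hchitau Htau].
  apply IZR_le in Hm. rewrite <- INR_IZR_INZ in Hm.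
  assert (Hlow : - 2 * PI * IZR m <= Rmin c (A (1 / 2, M))).
  { pose proof (pos_INR n0). nra. }
  assert (Hlc := Rle_trans _ _ _ Hlow (Rmin_l _ _)).
  assert (HlA := Rle_trans _ _ _ Hlow (Rmin_r _ _)).
  (* On the lines [T <= t <= T'] the argument is at least [c], so [D_m] stays
     above them; there chi' does not vanish and [D_m] is open. *)
  assert (Hhigh : forall s, D_m A M1 M2 M m s -> T' < Im s /\
            - 2 * PI * (IZR m + 1) < A s < - 2 * PI * IZR m).
  { intros [x t] [phi [Hphi [[H1 _] H2]]]. rewrite <- H2 in Hphi. split; auto.
    apply Rnot_le_lt; intros Hle. simpl in H1, Hle. fold T in H1.
    specialize (Hc x). destruct Hle as [L|E].
    - pose proof (proj1 (Harg x) t T' ltac:(lra) L). lra.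
    - rewrite <- E in Hc. lra. }
  assert (HDm : forall s, T' < Im s -> - 2 * PI * (IZR m + 1) < A s < - 2 * PI * IZR m ->
            D_m A M1 M2 M m s).
  { intros s H1 H2. exists (A s); split; auto. split; auto. split; [fold T|]; lra. }
  assert (Hopen : forall s, D_m A M1 M2 M m s -> exists d, 0 < d /\
            forall w, Cmod (w - s) < d -> T' < Im w /\ D_m A M1 M2 M m w).
  { intros s Hs. destruct (Hhigh s Hs) as [H1 H2].
    destruct (continuous_C_R A s (proj1 HA s ltac:(lra))
      (Rmin (A s - - 2 * PI * (IZR m + 1)) (- 2 * PI * IZR m - A s))) as [d [Hd Hdd]].
    { apply Rmin_glb_lt; lra. }
    exists (Rmin d (Im s - T')); split; [apply Rmin_glb_lt; lra|]; intros w Hw.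
    specialize (Hdd w (Rlt_le_trans _ _ _ Hw (Rmin_l _ _))).
    assert (Hw2 := Rlt_le_trans _ _ _ Hw (Rmin_r _ _)).
    pose proof (Rle_lt_trans _ _ _ (im_le_Cmod _) Hw2) as Hi.
    replace (Im (w - s)) with (Im w - Im s) in Hi by reflexivity.
    apply Rabs_lt_between in Hi, Hdd.
    pose proof (Rmin_l (A s - - 2 * PI * (IZR m + 1)) (- 2 * PI * IZR m - A s)).
    pose proof (Rmin_r (A s - - 2 * PI * (IZR m + 1)) (- 2 * PI * IZR m - A s)).
    split; [lra|]. apply HDm; lra. }
  assert (Hder : forall s, T' < Im s -> exists l, l <> RtoC 0 /\ cderiv chi s l).
  { intros s Hs. destruct (cderiv_chi_sign s ltac:(lra)) as [l [Hl [Hre _]]].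
    exists (chi s * l)%C; split; auto. apply Cmult_neq_0.
    - destruct s as [x t]; apply Hchi. simpl in Hs; lra.
    - intros E; rewrite E in Hre; simpl in Hre; lra. }
  (* The open map gives every w near z a preimage s close to tau z and still in [D_m]; since [tau]
     inverts chi on [D_m], this s is tau w. *)
  assert (Hcont : forall z, slit_plane z -> cont_at tau z).
  { intros z Hz eps He. destruct (Htau z Hz) as [Hs Ez].
    destruct (Hopen _ Hs) as [d [Hd Hdd]].
    destruct (cderiv_open_map chi (tau z) d (Rmin d eps) Hd) as [rho [Hrho Hsurj]].
    { apply Rmin_glb_lt; auto. }
    { intros w Hw; apply Hder, Hdd, Hw. }
    exists rho; split; auto; intros w Hw. rewrite <- Ez in Hw at 1.
    destruct (Hsurj w Hw) as [s [Hs1 <-]].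
    destruct (Hchitau s) as [_ ->].
    - apply Hdd, Rlt_le_trans with (1 := Hs1), Rmin_l.
    - apply Rlt_le_trans with (1 := Hs1), Rmin_r. }
  split; [|split; [|split]].
  - apply open_of_Cmod_ball, slit_plane_ball.
  - intros z Hz. destruct (Htau z Hz) as [Hs Ez].
    destruct (Hder (tau z) (proj1 (Hhigh _ Hs))) as [l [Hl Hdl]].
    destruct (slit_plane_ball z Hz) as [d [Hd Hdd]].
    exists (/ l)%C; split.
    + apply cderiv_is_derive, cderiv_inverse with (f := chi) (d := d); auto.
      intros w Hw; apply Htau, Hdd, Hw.
    + intros E. apply C1_nz. rewrite <- (Cinv_r l Hl), E. ring.
  - intros z1 z2 Hz1 Hz2 E.
    destruct (Htau z1 Hz1) as [_ <-]; destruct (Htau z2 Hz2) as [_ <-]. congruence.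
  - intros s; split.
    + intros Hs; destruct (Hchitau s Hs) as [Hv E]; exists (chi s); auto.
    + intros [z [Hz <-]]; apply Htau, Hz.
Qed.
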